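(* For any integer $k>2$ and $\epsilon>0$, there exists a positive integer $N$ such that any algorithm that is given sample access to two distributions $p$ and $q$ over $[N]=\{1,\dots,N\}$ and can distinguish between the cases $p=q$ and $\|p-q\|_{\mathcal{A}_k}\ge\epsilon$ with probability at least $2/3$ requires at least $\Omega(\max\{k^{4/5}/\epsilon^{6/5},\,k^{1/2}/\epsilon^2\})$ samples.
   Context: For discrete distributions $p,q$ on $[N]$ and a positive integer $k$, $\|p-q\|_{\mathcal{A}_k}=\max\sum_{i=1}^k|p(I_i)-q(I_i)|$ over all partitions of $[N]$ into $k$ disjoint intervals of consecutive integers, where $p(J)=\sum_{i\in J}p_i$.
   Formalization: The formal theorem assumes ε ≤ 2: since ‖p−q‖_{A_k} ≤ 2 always, for ε > 2 no pair is ε-far and the algorithm that always answers ''p = q'' with no samples is correct, so the positive lower bound stated for all ε > 0 fails there. *)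

(* Defs.v *)
From mathcomp Require Import all_boot all_order all_algebra.
From mathcomp Require Import all_classical all_reals all_analysis.
Set Implicit Arguments.
Unset Strict Implicit.
Unset Printing Implicit Defensive.
Import Order.TTheory GRing.Theory Num.Theory.
Local Open Scope ring_scope.

(* The domain [N] = {1, ..., N} is represented by 'I_N = {0, ..., N-1}. *)

Definition is_distr (R : realType) (N : nat) (p : {ffun 'I_N -> R}) : Prop :=
  (forall i, 0 <= p i) /\ \sum_(i < N) p i = 1.

Definition mass (R : realType) (N : nat) (p : {ffun 'I_N -> R})
    (J : {set 'I_N}) : R :=
  \sum_(i in J) p i.

Definition is_interval (N : nat) (J : {set 'I_N}) : bool :=
  [forall a in J, forall b in J, forall i : 'I_N,
     ((a <= i)%N && (i <= b)%N) ==> (i \in J)].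

(* Blocks of the partition may be empty; as soon as k <= N this does not change
   the maximum defining Ak_dist. *)
Definition interval_partition (N k : nat) (I : {ffun 'I_k -> {set 'I_N}}) :
    bool :=
  [&& [forall a, is_interval (I a)],
      [forall a, forall b, (a != b) ==> [disjoint I a & I b]]
    & \bigcup_(a < k) I a == [set: 'I_N]].

(* For k > 0 there is an admissible I, and all values are nonnegative, so the
   default value 0 of the iterated maximum plays no role. *)
Definition Ak_dist (R : realType) (N k : nat) (p q : {ffun 'I_N -> R}) : R :=
  \big[Num.max/0]_(I : {ffun 'I_k -> {set 'I_N}} | interval_partition I)
     \sum_(a < k) `|mass p (I a) - mass q (I a)|.

(* A (randomized, adaptive) algorithm with sample access to two unknown
   distributions p and q over 'I_N: at each step it stops with an answer
   (true for "p = q", false for "p and q are far"), flips a coin of bias r and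
   goes to the first branch with probability r, or draws a fresh independent
   sample from p or from q and goes on depending on the value drawn. *)
Inductive algorithm (R : realType) (N : nat) : Type :=
  | Answer of bool
  | Toss of {i01 R} & algorithm R N & algorithm R N
  | DrawP of ('I_N -> algorithm R N)
  | DrawQ of ('I_N -> algorithm R N).

(* Number of samples (from p and q together) used in the worst case *)
Fixpoint nsamples (R : realType) (N : nat) (A : algorithm R N) : nat :=
  match A with
  | Answer _ => 0
  | Toss _ A1 A2 => maxn (nsamples A1) (nsamples A2)
  | DrawP next => (\max_(i < N) nsamples (next i)).+1
  | DrawQ next => (\max_(i < N) nsamples (next i)).+1
  end.

(* Probability that A, run on p and q, answers b *)
Fixpoint answer_prob (R : realType) (N : nat) (p q : {ffun 'I_N -> R})
    (A : algorithm R N) (b : bool) : R :=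
  match A with
  | Answer b' => (b' == b)%:R
  | Toss r A1 A2 => r%:num * answer_prob p q A1 b
                    + (1 - r%:num) * answer_prob p q A2 b
  | DrawP next => \sum_(i < N) p i * answer_prob p q (next i) b
  | DrawQ next => \sum_(i < N) q i * answer_prob p q (next i) b
  end.

Definition Ak_closeness_tester (R : realType) (N k : nat) (eps : R)
    (A : algorithm R N) : Prop :=
  forall p q : {ffun 'I_N -> R}, is_distr p -> is_distr q ->
    (p = q -> 2 / 3 <= answer_prob p q A true) /\
    (eps <= Ak_dist k p q -> 2 / 3 <= answer_prob p q A false).

(* Hence for eps > 2 no pair is eps-far, and the algorithm that accepts without
   drawing any sample is a tester: lower bounds only make sense for eps <= 2. *)
Lemma Ak_dist_le2 (R : realType) (N k : nat) (p q : {ffun 'I_N -> R}) :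
  is_distr p -> is_distr q -> Ak_dist k p q <= 2.
Proof.
move=> [p0 p1] [q0 q1]; apply: (big_ind (fun x => x <= 2)) => //.
  by move=> x y x2 y2; rewrite ge_max x2.
move=> I /and3P[_ /forallP dI /eqP cI].
have Imass (r : {ffun 'I_N -> R}) :
    \sum_i r i = 1 -> \sum_(a < k) mass r (I a) = 1.
  move=> <-; transitivity (\sum_(i in \bigcup_(a < k) I a) r i); last first.
    by rewrite cI; apply: eq_bigl => i; rewrite inE.
  rewrite (partition_disjoint_bigcup _ _) // => a b ab.
  by move: (dI a) => /forallP/(_ b); rewrite ab.
apply: (@le_trans _ _ (\sum_(a < k) (mass p (I a) + mass q (I a)))).
  apply: ler_sum => a _; rewrite (le_trans (ler_normB _ _)) //.
  by rewrite !ger0_norm ?sumr_ge0.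
by rewrite big_split /= !Imass.
Qed.

Lemma tester_gt2 (R : realType) (N k : nat) (eps : R) :
  2 < eps -> Ak_closeness_tester k eps (Answer R N true).
Proof.
move=> eps2 p q dp dq; split=> [_ /=|].
  by rewrite ler_pdivrMr ?ltr0n // mul1r ler_nat.
by move=> far; have := lt_le_trans eps2 (le_trans far (Ak_dist_le2 k dp dq)); rewrite ltxx.
Qed.

(* Main.v *)
Require Import Defs.
From mathcomp Require Import all_boot all_order all_algebra.
From mathcomp Require Import all_classical all_reals all_analysis.
From mathcomp Require Import finset ring lra zify.
Set Implicit Arguments.
Unset Strict Implicit.
Unset Printing Implicit Defensive.
Import Order.TTheory GRing.Theory Num.Theory.

(** The bound is the maximum of two terms.

    For [k^(1/2) / eps^2], [p] is uniform on [2 h] points and [q] is [p] tilted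
    by [1 +- eps] with random signs on the [h] pairs of points; the second moment
    of the likelihood ratio of [n] samples is at most [cosh (n eps^2 / h) ^ h].

    For [k^(4/5) / eps^(6/5)], Ramsey's theorem provides a large set of points on
    which the answer of the algorithm depends only on the relative order of the
    samples. On such a set take [p = q] uniform, cut into [K r] blocks of [D]
    cells, so that each block receives few samples. In the alternative
    hypothesis, one random block out of each group of [r] is selected, and in its
    first [L] cells the samples of [q] are moved to both sides of those of [p].
    Two samples in a modified cell are still ordered uniformly, so that only
    cells with three samples carry information: the laws of the order of [t]
    samples in a block are at distance [O(t^3 L / D^3)], while under the null
    hypothesis every order has probability at least [(2 t)^-t]. As the blocks are
    independent given their numbers of samples, the chi-square distance is
    [O(n (L / (r D^3))^2)], whereas [p] and [q] are at distance [2 L / (r D)]. *)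

(** * Ramsey's theorem *)

(** [N] is fixed before the algorithm, but the embedding [e] of the cells into ['I_N] depends on it:
    each algorithm has its own hard instance. Ramsey's theorem needs finitely many colours, so
    acceptance probabilities are rounded to multiples of [1 / 100]; it is silent on repeated
    samples, so the thirds of the cells are made long enough for repetitions to be rare.

    The exponents come from a balance. Let [K r], [K L] and [L / (r D)] be of order [n], [k] and
    [eps]. Then [n (L / (r D^3))^2] is of order [n eps^6 (r / L)^4], and [r / L] is of order
    [n / k], which gives [n^5 eps^6 / k^4]: bounded up to [n] of order [k^(4/5) / eps^(6/5)]. Only
    the ratio [r / L] matters, so [r = 1] serves when [n] is small against [k], and [L = 1]
    otherwise.

    The number of blocks must exceed a large multiple of [n] because the weight [(2 t)^t], the
    inverse of the least probability of an order, has to be summable against the probability that a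
    block receives [t] samples. *)

Fixpoint end_homogeneous (T : eqType) (C : Type) (m : nat) (chi : seq T -> C)
    (z : seq (T * C)) : Prop :=
  if z is (x, c) :: z' then
    (forall u, subseq u (unzip1 z') -> size u = m -> chi (x :: u) = c)
    /\ end_homogeneous m chi z'
  else True.

Lemma end_homogeneous_subseq (T C : eqType) m (chi : seq T -> C) z z' :
  subseq z' z -> end_homogeneous m chi z -> end_homogeneous m chi z'.
Proof.
elim: z z' => [|[x c] z IHz] [|[x' c'] z'] //=.
case: eqP => [[-> ->]|_] sz' [xz hz]; last exact: (IHz ((x', c') :: z')).
split; last exact: IHz.
by move=> u uz'; apply: xz; apply: subseq_trans uz' (map_subseq _ sz').
Qed.

Lemma end_homogeneous_mono (T C : eqType) m (chi : seq T -> C) z c :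
  end_homogeneous m chi z -> all (fun xc => xc.2 == c) z ->
  forall u, subseq u (unzip1 z) -> size u = m.+1 -> chi u = c.
Proof.
elim: z => [|[x c'] z IHz] /=; first by move=> _ _ [].
move=> [xz hz] /andP[/eqP c'c az] [|y u] //.
case: eqP => [->|_] sub [su]; first by rewrite xz.
by apply: IHz => //=; rewrite su.
Qed.

Lemma count_pigeonhole (T : Type) (C : finType) (f : T -> C) (s : seq T) n :
  #|C| * n < size s -> exists c, n < count (fun x => f x == c) s.
Proof.
move=> sn; apply/existsP; apply: contraLR sn => /existsPn h.
have -> : size s = \sum_c count (fun x => f x == c) s.
  elim: s {h} => [|x s IHs] /=; first by rewrite big1.
  rewrite big_split /= -IHs (bigD1 (f x)) //= eqxx big1 ?addn0 // => c.
  by rewrite eq_sym => /negPf ->.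
rewrite -leqNgt -sum_nat_const; apply: leq_sum => c _.
by rewrite leqNgt h.
Qed.

(** Subsets are subsequences, and [N] is uniform in [T], [chi] and [s]. In the induction on [m], the
    head [x] is set aside and the induction hypothesis for [fun u => chi (x :: u)] thins out the
    tail; iterating, the colour of a subsequence depends only on its first element
    ([end_homogeneous], which records that colour). The pigeonhole principle then selects [M]
    elements of equal recorded colour. *)
Lemma ramsey (C : finType) (m M : nat) :
  exists N, forall (T : eqType) (chi : seq T -> C) (s : seq T), N <= size s ->
    exists (t : seq T) (c : C), [/\ subseq t s, size t = M &
      forall u, subseq u t -> size u = m -> chi u = c].
Proof.
elim: m M => [|m IHm] M.
  exists M => T chi s Ms; exists (take M s), (chi [::]); split.
  - by apply: take_subseq.
  - by rewrite size_takel.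
  - by move=> [|//].
have [N0 hN0] : exists N, forall (T : eqType) (chi : seq T -> C) (s : seq T),
    N <= size s -> exists z, [/\ subseq (unzip1 z) s, size z = (#|C| * M).+1 &
      end_homogeneous m chi z].
  elim: (_.+1) => [|M' [N hN]]; first by exists 0 => T chi s _; exists [::]; rewrite sub0seq.
  have [N' hN'] := IHm N; exists N'.+1 => T chi [//|x s] /= Ns.
  have [t [c [ts st ht]]] := hN' T (fun u => chi (x :: u)) s Ns.
  have [z [zt sz hz]] := hN T chi t (eq_leq (esym st)).
  exists ((x, c) :: z); split => /=; [|by rewrite sz|].
    by rewrite eqxx (subseq_trans zt).
  by split=> // u uz; apply: ht; apply: subseq_trans zt.
exists N0 => T chi s Ns; have [z [zs sz hz]] := hN0 T chi s Ns.
have [c hc] : exists c, M < count (fun xc => xc.2 == c) z.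
  by apply: count_pigeonhole; rewrite sz.
pose z' := [seq xc <- z | xc.2 == c].
have sz' : M <= size z' by rewrite size_filter ltnW.
exists (take M (unzip1 z')), c; split.
- apply: subseq_trans (take_subseq _ _) (subseq_trans (map_subseq _ _) zs).
  exact: filter_subseq.
- by rewrite size_takel // size_map.
- move=> u ut; apply: (@end_homogeneous_mono _ _ _ _ z').
  + exact: end_homogeneous_subseq (filter_subseq _ _) hz.
  + exact: filter_all.
  + exact: subseq_trans ut (take_subseq _ _).
Qed.
Local Open Scope ring_scope.

(** * Order patterns, and algorithms that see only the order *)

Definition pattern (m : nat) := {ffun 'I_m * 'I_m -> bool}.

Definition pat (m : nat) (x : 'I_m -> nat) : pattern m :=
  [ffun ij => (x ij.1 < x ij.2)%N].

Lemma index_sorted_ltn (s : seq nat) y :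
  sorted ltn s -> y \in s -> index y s = count (fun z => (z < y)%N) s.
Proof.
elim: s => [//|z s IHs] /= pzs; rewrite inE.
have [<- _|nzy /=] := eqVneq z y.
  rewrite ltnn add0n (@eq_in_count _ _ pred0) ?count_pred0 // => w ws.
  have /allP/(_ w ws) /= := order_path_min ltn_trans pzs.
  by move/ltnW; rewrite leqNgt => /negPf.
move=> ys; have /allP/(_ y ys) /= := order_path_min ltn_trans pzs.
by move=> zy; rewrite zy add1n IHs // (path_sorted pzs).
Qed.

(** The colour of an [m]-subset lists, for every way [r] of arranging its elements, the value of [F]
    rounded down to a multiple of [1 / 100]. On a homogeneous set this list is constant, so up to
    the rounding [F] depends only on the arrangement, that is on the pattern. *)
Lemma ramsey_order (R : archiRealFieldType) (m M : nat) :
  exists N, (0 < N)%N /\ forall F : {ffun 'I_m -> 'I_N} -> R,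
    (forall z, 0 <= F z <= 1) ->
    exists (e : 'I_M -> 'I_N) (G : pattern m -> R),
      [/\ forall a b : 'I_M, (a < b)%N -> (e a < e b)%N,
          forall o, 0 <= G o <= 1 &
          forall x : 'I_m -> 'I_M, injective x ->
            `|F [ffun i => e (x i)] - G (pat (fun i => x i))| <= 1 / 100].
Proof.
pose C := {ffun {ffun 'I_m -> 'I_m.+1} -> 'I_101}.
have [N hN] := ramsey C m M; exists N.+1; split=> // F F01.
pose chi (u : seq 'I_N.+1) : C :=
  [ffun r : {ffun 'I_m -> 'I_m.+1} => inord (Num.truncn (100 * F [ffun i => nth ord0 u (r i)]))].
have [|t [c [ts st tc]]] := hN _ chi (enum 'I_N.+1); first by rewrite size_enum_ord.
pose e (a : 'I_M) := nth ord0 t a.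
(* A pattern determines the rank of each entry, hence the arrangement to look up in the colour. The
   codomain ['I_m.+1] is inhabited even if [m = 0], as [inord] requires. *)
pose rk (o : pattern m) : {ffun 'I_m -> 'I_m.+1} := [ffun i => inord #|[set j | o (j, i)]|].
exists e, (fun o => (c (rk o) : nat)%:R / 100); split.
- have sorted_t : sorted (relpre val ltn) t.
    apply: (subseq_sorted _ ts); first by move=> x y z; apply: ltn_trans.
    by rewrite -sorted_map val_enum_ord iota_ltn_sorted.
  move=> a b ab; apply: (sorted_ltn_nth _ ord0 sorted_t) => //.
  + by move=> x y z; apply: ltn_trans.
  + by rewrite inE st.
  + by rewrite inE st.
- move=> o; rewrite divr_ge0 ?ler0n //= ler_pdivrMr ?ltr0n // mul1r ler_nat.
  by rewrite -ltnS ltn_ord.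
- move=> x xI.
  (* [A] is the image of [x] in increasing order and [u] its copy in [t]; the rank of [x i] is its
     index in [A]. *)
  pose A := [seq a <- enum 'I_M | a \in codom x].
  pose u := map e A.
  have eE : map e (enum 'I_M) = t.
    apply: (@eq_from_nth _ ord0); first by rewrite size_map size_enum_ord st.
    move=> k; rewrite size_map size_enum_ord => kM.
    by rewrite (nth_map (Ordinal kM)) ?size_enum_ord // /e nth_enum_ord.
  have ut : subseq u t by rewrite -eE; apply: map_subseq; apply: filter_subseq.
  have sA : size A = m.
    rewrite -[RHS](card_ord m) -(card_codom xI) cardE; apply/perm_size/uniq_perm.
    - by rewrite filter_uniq ?enum_uniq.
    - exact: enum_uniq.
    - by move=> a; rewrite mem_filter !mem_enum andbT.
  have {tc} tcu : chi u = c by apply: tc => //; rewrite size_map.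
  have nthu i : nth ord0 u (rk (pat (fun i => x i)) i) = e (x i).
    have xiA : x i \in A by rewrite mem_filter codom_f mem_enum.
    have mE : map val A = [seq a <- iota 0 M | a \in map val (codom x)].
      rewrite -val_enum_ord filter_map; congr map; apply: eq_filter => a /=.
      by rewrite mem_map //; apply: val_inj.
    have idx : #|[set j | (x j < x i)%N]| = index (x i) A.
      rewrite -(index_map val_inj) index_sorted_ltn.
      - rewrite -(card_imset _ xI) cardE count_map -size_filter.
        apply/perm_size/uniq_perm.
        + exact: enum_uniq.
        + by rewrite filter_uniq // filter_uniq // enum_uniq.
        move=> a; rewrite mem_enum mem_filter /A mem_filter mem_enum andbT.
        apply/imsetP/andP => [[j]|[axi /codomP [j aj]]].
          by rewrite inE => xj ->; rewrite codom_f.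
        by exists j; rewrite ?inE -?aj.
      - by rewrite mE; apply: sorted_filter; [apply: ltn_trans|apply: iota_ltn_sorted].
      - by rewrite (mem_map val_inj).
    rewrite ffunE inordK; last by rewrite ltnS -[leqRHS]card_ord max_card.
    rewrite (_ : #|_| = index (x i) A).
      by rewrite (nth_map (x i)) ?nth_index // index_mem.
    by rewrite -idx; apply: eq_card => j; rewrite !inE ffunE.
  rewrite -tcu ffunE.
  set y := [ffun i => nth ord0 u _].
  have -> : y = [ffun i => e (x i)] by apply/ffunP => i; rewrite [LHS]ffunE [RHS]ffunE nthu.
  move: (F01 [ffun i => e (x i)]); set f := F _ => /andP[f0 f1].
  have f100 : 0 <= 100 * f by rewrite mulr_ge0.
  have /andP[lo hi] := @truncn_itv R _ f100.
  have t100 : (Num.truncn (100 * f) < 101)%N.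
    rewrite -(ltr_nat R) (le_lt_trans lo) //.
    by rewrite (@le_lt_trans _ _ 100) ?ltr_nat // ler_piMr.
  move: lo hi; rewrite inordK // -(natr1 (Num.truncn _)); move: (Num.truncn _)%:R => tr lo hi.
  have -> : f - tr / 100 = (100 * f - tr) / 100 by rewrite mulrBl [100 * f]mulrC mulfK ?pnatr_eq0.
  rewrite ger0_norm ?divr_ge0 ?subr_ge0 // ler_pM2r ?invr_gt0 //.
  by rewrite lerBlDr ltW // addrC.
Qed.

(** * Nonadaptive algorithms *)

(** Iterated sums follow the recursion of [answer_prob]; [seq_expect_ffun] converts them into a
    single sum over sample vectors. *)
Fixpoint seq_expect (R : realType) (T : finType) (n : nat) (d : nat -> T -> R)
    (f : seq T -> R) : R :=
  if n is n'.+1 then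
    \sum_x d 0 x * seq_expect n' (fun i => d i.+1) (fun s => f (x :: s))
  else f [::].

Lemma seq_expect_ffun (R : realType) (T : finType) n (d : nat -> T -> R) f :
  seq_expect n d f =
  \sum_(z : {ffun 'I_n -> T}) (\prod_(i < n) d i (z i)) * f [seq z i | i <- enum 'I_n].
Proof.
elim: n d f => [|n IHn] d f /=.
  rewrite (big_pred1 [ffun i : 'I_0 => ffun0 (card_ord 0) i]) => [|z].
    by rewrite big_ord0 mul1r (size0nil (size_enum_ord 0)).
  by apply/esym/eqP/ffunP => -[].
pose cons_ffun (xz : T * {ffun 'I_n -> T}) : {ffun 'I_n.+1 -> T} :=
  [ffun i => if unlift ord0 i is Some j then xz.2 j else xz.1].
have bij : bijective cons_ffun.
  exists (fun z : {ffun 'I_n.+1 -> T} => (z ord0, [ffun j => z (lift ord0 j)])) => [[x z]|z].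
    by congr (_, _); [rewrite ffunE unlift_none|apply/ffunP => j; rewrite !ffunE liftK].
  apply/ffunP => i; rewrite ffunE; case: unliftP => [j ->|->] //=.
  by rewrite ffunE.
rewrite (reindex cons_ffun) /=; last exact: onW_bij.
under eq_bigr do rewrite IHn big_distrr /=.
rewrite pair_big /=; apply: eq_bigr => -[x z] _ /=.
rewrite big_ord_recl mulrA enum_ordSl /= !ffunE unlift_none /=.
congr (_ * _ * f (_ :: _)).
  by apply: eq_bigr => i _; rewrite ffunE liftK.
by rewrite -map_comp; apply: eq_map => i /=; rewrite ffunE liftK.
Qed.

Lemma eq_seq_expect (R : realType) (T : finType) n (d : nat -> T -> R) f g :
  (forall s, size s = n -> f s = g s) -> seq_expect n d f = seq_expect n d g.
Proof.
elim: n d f g => [|n IHn] d f g fg /=; first exact: fg.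
by apply: eq_bigr => x _; congr (_ * _); apply: IHn => s sn; rewrite fg //= sn.
Qed.

Lemma seq_expectD (R : realType) (T : finType) n (d : nat -> T -> R) a b f g :
  seq_expect n d (fun s => a * f s + b * g s) =
  a * seq_expect n d f + b * seq_expect n d g.
Proof.
elim: n d f g => [//|n IHn] d f g /=.
rewrite !big_distrr -big_split; apply: eq_bigr => x _ /=.
by rewrite IHn mulrDr !(mulrCA (d 0 x)).
Qed.

Lemma seq_expect_cst (R : realType) (T : finType) n (d : nat -> T -> R) a :
  (forall i, \sum_x d i x = 1) -> seq_expect n d (fun=> a) = a.
Proof.
elim: n d => [//|n IHn] d d1 /=; rewrite -[RHS]mul1r -(d1 0) big_distrl /=.
by apply: eq_bigr => x _; rewrite IHn.
Qed.

Lemma seq_expect_sum (R : realType) (T I : finType) n (d : nat -> T -> R)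
    (c : I -> R) (f : I -> seq T -> R) :
  seq_expect n d (fun s => \sum_i c i * f i s) = \sum_i c i * seq_expect n d (f i).
Proof.
elim: n d f => [//|n IHn] d f /=.
under eq_bigr do rewrite IHn big_distrr /=.
rewrite exchange_big /=; apply: eq_bigr => i _; rewrite big_distrr /=.
by apply: eq_bigr => x _; rewrite mulrCA.
Qed.

Lemma seq_expect_cat (R : realType) (T : finType) n m (d : nat -> T -> R) f :
  seq_expect (n + m) d f =
  seq_expect n d (fun s => seq_expect m (fun i => d (n + i)%N) (fun t => f (s ++ t))).
Proof.
elim: n d f => [//|n IHn] d f.
by rewrite addSn /=; apply: eq_bigr => x _; rewrite IHn.
Qed.

(* Samples are read from two prerecorded tapes; the value 0 on an exhausted
   tape is never used when the tapes have length at least [nsamples A]. *)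
Fixpoint run (R : realType) (N : nat) (A : algorithm R N) (b : bool)
    (xs ys : seq 'I_N) : R :=
  match A with
  | Answer b' => (b' == b)%:R
  | Toss r A1 A2 => r%:num * run A1 b xs ys + (1 - r%:num) * run A2 b xs ys
  | DrawP next => if xs is x :: xs' then run (next x) b xs' ys else 0
  | DrawQ next => if ys is y :: ys' then run (next y) b xs ys' else 0
  end.

Lemma run_ge0_le1 (R : realType) N (A : algorithm R N) b xs ys :
  0 <= run A b xs ys <= 1.
Proof.
elim: A xs ys => [b'|r A1 IH1 A2 IH2|next IH|next IH] xs ys /=.
- by rewrite ler0n lern1; case: (_ == _).
- have /andP[a0 a1] := IH1 xs ys; have /andP[c0 c1] := IH2 xs ys.
  have r0 : 0 <= r%:num by []. have r1 : 0 <= 1 - r%:num by rewrite subr_ge0.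
  rewrite addr_ge0 ?mulr_ge0 //= -[leRHS](subrK r%:num) addrC.
  by rewrite lerD // ler_piMr.
- by case: xs => [|x xs]; rewrite ?lexx ?ler01.
- by case: ys => [|y ys]; rewrite ?lexx ?ler01.
Qed.

(** Samples are independent, so they can be drawn in advance; adaptivity only decides which tape is
    read next. *)
Lemma expect_run (R : realType) N (A : algorithm R N) b n m (p q : {ffun 'I_N -> R}) :
  is_distr p -> is_distr q -> (nsamples A <= n)%N -> (nsamples A <= m)%N ->
  seq_expect n (fun=> p) (fun xs => seq_expect m (fun=> q) (run A b xs)) =
  answer_prob p q A b.
Proof.
move=> [p0 p1] [q0 q1].
elim: A n m => [b'|r A1 IH1 A2 IH2|next IH|next IH] n m /=.
- by rewrite !seq_expect_cst.
- rewrite !geq_max => /andP[? ?] /andP[? ?]; rewrite -(IH1 n m) -?(IH2 n m) // -seq_expectD.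
  by apply: eq_seq_expect => xs _; rewrite -seq_expectD.
- case: n => // n; rewrite ltnS => /bigmax_leqP nn mn /=; apply: eq_bigr => x _.
  congr (_ * _); apply: IH; first exact: nn.
  by rewrite (leq_trans _ (ltnW mn)) // (leq_bigmax x).
- case: m => // m; rewrite ltnS => nn /bigmax_leqP mn /=; rewrite seq_expect_sum.
  apply: eq_bigr => y _; congr (_ * _); apply: IH; last exact: mn.
  by rewrite (leq_trans _ (ltnW nn)) // (leq_bigmax y).
Qed.

(** Recording [n] samples of each distribution suffices whatever mixture the algorithm asks for, at
    the price of doubling their number. *)
Lemma nonadaptive (R : realType) N (A : algorithm R N) b n : (nsamples A <= n)%N ->
  exists F : {ffun 'I_(n + n) -> 'I_N} -> R, (forall z, 0 <= F z <= 1) /\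
    forall p q : {ffun 'I_N -> R}, is_distr p -> is_distr q ->
      answer_prob p q A b =
      \sum_(z : {ffun 'I_(n + n) -> 'I_N})
        (\prod_(i < n + n) (if (i < n)%N then p else q) (z i)) * F z.
Proof.
move=> An; pose F s := run A b (take n s) (drop n s).
exists (fun z : {ffun 'I_(n + n) -> 'I_N} => F [seq z i | i <- enum 'I_(n + n)]); split.
  by move=> z; apply: run_ge0_le1.
move=> p q dp dq.
rewrite -(seq_expect_ffun _ (fun i x => (if (i < n)%N then p else q) x)).
rewrite seq_expect_cat -(expect_run b dp dq An An).
have swap (d1 d2 d1' d2' : nat -> 'I_N -> R) f :
    (forall i, (i < n)%N -> d1 i = d1' i) -> (forall i, d2 i = d2' i) ->
    seq_expect n d1 (fun s => seq_expect n d2 (f s)) =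
    seq_expect n d1' (fun s => seq_expect n d2' (f s)).
  move=> e1 e2; rewrite (_ : d2 = d2'); last exact: boolp.funext.
  rewrite !seq_expect_ffun; apply: eq_bigr => z _; congr (_ * _).
  by apply: eq_bigr => i _; rewrite e1.
rewrite (swap _ _ (fun=> p) (fun=> q)) //=.
- apply: eq_seq_expect => s sn; apply: eq_seq_expect => t _.
  by rewrite /F -sn take_size_cat ?drop_size_cat.
- by move=> i ->.
- by move=> i; rewrite ltnNge leq_addr.
Qed.

(** * Averages and second moments *)

Lemma big_pairE (R : Type) (idx : R) (op : Monoid.com_law idx) (I J : finType)
    (F : I * J -> R) :
  \big[op/idx]_p F p = \big[op/idx]_i \big[op/idx]_j F (i, j).
Proof. by rewrite pair_bigA; apply: eq_bigr => -[]. Qed.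

Definition avg (R : realFieldType) (T : finType) (f : T -> R) : R :=
  (\sum_x f x) / #|T|%:R.

Lemma eq_avg (R : realFieldType) (T : finType) (f g : T -> R) : f =1 g -> avg f = avg g.
Proof. by move=> fg; rewrite /avg (eq_bigr _ (fun x _ => fg x)). Qed.

Lemma avg_cst (R : realFieldType) (T : finType) (a : R) : (0 < #|T|)%N ->
  avg (fun _ : T => a) = a.
Proof.
by move=> T0; rewrite /avg sumr_const -[a *+ _]mulr_natr mulfK // pnatr_eq0 -lt0n.
Qed.

Lemma avgD (R : realFieldType) (T : finType) (f g : T -> R) :
  avg (fun x => f x + g x) = avg f + avg g.
Proof. by rewrite /avg big_split mulrDl. Qed.

Lemma avgB (R : realFieldType) (T : finType) (f g : T -> R) :
  avg (fun x => f x - g x) = avg f - avg g.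
Proof. by rewrite /avg sumrB mulrBl. Qed.

Lemma avgZ (R : realFieldType) (T : finType) a (f : T -> R) :
  avg (fun x => a * f x) = a * avg f.
Proof. by rewrite /avg -big_distrr /= mulrA. Qed.

Lemma avgZr (R : realFieldType) (T : finType) a (f : T -> R) :
  avg (fun x => f x * a) = avg f * a.
Proof. by rewrite mulrC -avgZ; apply: eq_avg => x; rewrite mulrC. Qed.

Lemma avg_sum (R : realFieldType) (T I : finType) (P : pred I) (f : I -> T -> R) :
  avg (fun x => \sum_(i | P i) f i x) = \sum_(i | P i) avg (f i).
Proof. by rewrite /avg exchange_big /= big_distrl. Qed.

Lemma ler_avg (R : realFieldType) (T : finType) (f g : T -> R) :
  (forall x, f x <= g x) -> avg f <= avg g.
Proof. by move=> fg; rewrite ler_wpM2r ?invr_ge0 // ler_sum. Qed.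

Lemma avg_ge0 (R : realFieldType) (T : finType) (f : T -> R) :
  (forall x, 0 <= f x) -> 0 <= avg f.
Proof. by move=> f0; rewrite divr_ge0 ?sumr_ge0. Qed.

Lemma ler_norm_avg (R : realFieldType) (T : finType) (f : T -> R) :
  `|avg f| <= avg (fun x => `|f x|).
Proof.
by rewrite normrM [`|_^-1|]ger0_norm ?invr_ge0 // ler_wpM2r ?invr_ge0 // ler_norm_sum.
Qed.

Lemma avg_pair (R : realFieldType) (T U : finType) (f : T * U -> R) :
  avg f = avg (fun x => avg (fun y => f (x, y))).
Proof.
rewrite /avg card_prod natrM invfM big_pairE.
by rewrite -[in RHS]big_distrl /= -!mulrA; congr (_ * _); rewrite mulrC.
Qed.

Lemma avg_exchange (R : realFieldType) (T U : finType) (f : T -> U -> R) :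
  avg (fun x => avg (f x)) = avg (fun y => avg (f^~ y)).
Proof. by rewrite /avg -!big_distrl /= exchange_big /= mulrAC. Qed.

Lemma avg_bij (R : realFieldType) (T U : finType) (h : T -> U) (f : U -> R) :
  bijective h -> avg (fun x => f (h x)) = avg f.
Proof.
move=> bh; rewrite /avg (bij_eq_card bh); congr (_ / _).
by rewrite [RHS](reindex h) //=; apply: onW_bij.
Qed.

Lemma avg_ffun_prod (R : realFieldType) (I T : finType) (g : I -> T -> R) :
  avg (fun w : {ffun I -> T} => \prod_i g i (w i)) = \prod_i avg (g i).
Proof.
rewrite /avg -bigA_distr_bigA /= card_ffun natrX big_split /=.
by rewrite prodr_const exprVn.
Qed.

(** The averaged likelihood ratio [F] satisfies [|F - 1| <= alpha / 2 + (F - 1)^2 / (2 alpha)], a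
    form of Cauchy-Schwarz without square root. The mean of [(F - 1)^2] is the second moment minus
    1, and the square of an average is an average over two independent copies [z], [z']. *)
Lemma second_moment (R : realFieldType) (O Z : finType) (a : O -> R) (f : Z -> O -> R)
    (H : O -> R) (alpha : R) : 0 < alpha -> (0 < #|Z|)%N ->
    (forall o, 0 <= a o) -> \sum_o a o = 1 -> (forall o, 0 <= H o <= 1) ->
    (forall z, \sum_o a o * f z o = 1) ->
  `|avg (fun z => \sum_o a o * f z o * H o) - \sum_o a o * H o| <=
  alpha / 2 + (avg (fun z => avg (fun z' => \sum_o a o * (f z o * f z' o))) - 1)
              / (2 * alpha).
Proof.
move=> al0 Z0 a0 a1 H01 f1.
pose F o := avg (fun z => f z o).
have -> : avg (fun z => \sum_o a o * f z o * H o) = \sum_o a o * F o * H o.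
  rewrite avg_sum; apply: eq_bigr => o _.
  by rewrite -avgZ -avgZr.
have F1 : \sum_o a o * F o = 1.
  under eq_bigr do rewrite -avgZ.
  by rewrite -avg_sum (eq_avg f1) avg_cst.
have -> : avg (fun z => avg (fun z' => \sum_o a o * (f z o * f z' o))) =
          \sum_o a o * F o ^+ 2.
  transitivity (avg (fun z => \sum_o a o * (f z o * F o))).
    apply: eq_avg => z; rewrite avg_sum; apply: eq_bigr => o _.
    by rewrite !avgZ.
  rewrite avg_sum; apply: eq_bigr => o _.
  by rewrite avgZ avgZr expr2.
rewrite -sumrB.
apply: le_trans (ler_norm_sum _ _ _) _.
apply: (@le_trans _ _ (\sum_o a o * (alpha / 2 + (F o - 1) ^+ 2 / (2 * alpha)))).
  apply: ler_sum => o _; rewrite -mulrA -mulrBr -{2}[H o]mul1r -mulrBl mulrA !normrM.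
  rewrite (ger0_norm (a0 o)) -mulrA ler_wpM2l //.
  have /andP[h0 h1] := H01 o; rewrite (ger0_norm h0).
  apply: (le_trans (ler_piMr (normr_ge0 _) h1)).
  rewrite -[(F o - 1) ^+ 2]real_normK ?num_real //; set t := `|_|.
  rewrite -subr_ge0.
  have -> : alpha / 2 + t ^+ 2 / (2 * alpha) - t = (alpha - t) ^+ 2 / (2 * alpha).
    by field; rewrite gt_eqF.
  by rewrite divr_ge0 ?sqr_ge0 // mulr_ge0 // ltW.
have -> : \sum_o a o * (alpha / 2 + (F o - 1) ^+ 2 / (2 * alpha)) =
   (\sum_o a o) * (alpha / 2) + (\sum_o a o * F o ^+ 2 - 2 * (\sum_o a o * F o)
     + \sum_o a o) / (2 * alpha).
  transitivity (\sum_o (a o * (alpha / 2)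
      + (a o * F o ^+ 2 - 2 * (a o * F o) + a o) / (2 * alpha))).
    by apply: eq_bigr => o _; field; rewrite gt_eqF.
  by rewrite big_split -!big_distrl /= big_split sumrB -big_distrr.
by rewrite F1 a1 mul1r; rewrite lerD2l ler_wpM2r ?invr_ge0 ?mulr_ge0 ?(ltW al0) //; lra.
Qed.

(** The product is at most [1 / (1 - S)] with [S] the sum, and [1 / (1 - S) <= 1 + 2 S] for
    [S <= 1 / 2]. *)
Lemma prod_1D_le (R : realFieldType) (I : finType) (x : I -> R) :
  (forall i, 0 <= x i) -> \sum_i x i <= 1 / 2 ->
  \prod_i (1 + x i) - 1 <= 2 * \sum_i x i.
Proof.
move=> x0 S2.
suff : \prod_i (1 + x i) * (1 - \sum_i x i) <= 1.
  have S0 : 0 <= \sum_i x i by rewrite sumr_ge0.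
  by move: (\prod_i _) (\sum_i x i) S0 S2 => p S; nra.
(* The two signs are carried along because the induction step needs them. *)
suff [] : [/\ 0 <= \prod_i (1 + x i), 0 <= \sum_i x i &
  \prod_i (1 + x i) * (1 - \sum_i x i) <= 1] by [].
elim/big_rec2: _ => [|i S p _ [p0 S0 IH]]; first by rewrite subr0 mulr1; split.
have xi := x0 i; split; [by rewrite mulr_ge0 // addr_ge0|by rewrite addr_ge0|].
apply: le_trans IH; rewrite -subr_ge0.
have -> : p * (1 - S) - (1 + x i) * p * (1 - (x i + S)) = p * x i * (S + x i) by ring.
by rewrite !mulr_ge0 ?addr_ge0.
Qed.

Lemma sum_ffun_prod (R : realFieldType) (I T : finType) (g : I -> T -> R) :
  \sum_(w : {ffun I -> T}) \prod_i g i (w i) = \prod_i \sum_x g i x.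
Proof. by rewrite bigA_distr_bigA. Qed.

(* With [u = b / a - 1], the density is the average over [rho] of products of
   factors [1 + u], and [u] has mean 0: in its second moment only the places where
   two independent copies of [rho] agree contribute. *)
Lemma block_second_moment (R : realFieldType) (K L P : finType)
    (a b : K * L -> P -> R) (H : {ffun K * L -> P} -> R) (alpha : R) :
    0 < alpha -> alpha <= 1 / 2 -> (0 < #|L|)%N ->
    (forall j o, 0 <= a j o) -> (forall j o, 0 <= b j o) ->
    (forall j, \sum_o a j o = 1) -> (forall j, \sum_o b j o = 1) ->
    (forall j o, a j o = 0 -> b j o = 0) -> (forall o, 0 <= H o <= 1) ->
  `|avg (fun rho : {ffun K -> L} => \sum_(o : {ffun K * L -> P})
       (\prod_j (if rho j.1 == j.2 then b j (o j) else a j (o j))) * H o)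
    - \sum_(o : {ffun K * L -> P}) (\prod_j a j (o j)) * H o| <=
  alpha / 2 + (\sum_j \sum_o (b j o - a j o) ^+ 2 / a j o) / #|L|%:R ^+ 2 / alpha.
Proof.
move=> al0 al2 L0 a0 b0 a1 b1 ab H01.
(* Where [a j o = 0] the quotient is 0 by convention; [b j o] vanishes there too, so [auE] still
   holds. *)
pose u j o := b j o / a j o - 1.
have auE j o : a j o * (1 + u j o) = b j o.
  have [a00|an0] := eqVneq (a j o) 0; first by rewrite a00 mul0r ab.
  by rewrite /u addrC subrK mulrC divfK.
pose x j := \sum_o (b j o - a j o) ^+ 2 / a j o.
have auuE j o : a j o * u j o ^+ 2 = (b j o - a j o) ^+ 2 / a j o.
  have [a00|an0] := eqVneq (a j o) 0; first by rewrite a00 mul0r invr0 mulr0.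
  by rewrite /u; field.
pose A (o : {ffun K * L -> P}) := \prod_j a j (o j).
pose f (rho : {ffun K -> L}) (o : {ffun K * L -> P}) :=
  \prod_j (if rho j.1 == j.2 then 1 + u j (o j) else 1).
have AfE (rho : {ffun K -> L}) (o : {ffun K * L -> P}) :
    \prod_j (if rho j.1 == j.2 then b j (o j) else a j (o j)) = A o * f rho o.
  rewrite -big_split; apply: eq_bigr => j _ /=.
  by case: ifP => _; rewrite ?auE ?mulr1.
under eq_avg do under eq_bigr do rewrite AfE.
have A0 o : 0 <= A o by apply: prodr_ge0.
have A1 : \sum_o A o = 1 by rewrite sum_ffun_prod big1.
have Af0 rho o : 0 <= A o * f rho o.
  by rewrite -AfE; apply: prodr_ge0 => j _; case: ifP.
have Af1 rho : \sum_o A o * f rho o = 1.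
  under eq_bigr do rewrite -AfE.
  rewrite (sum_ffun_prod (fun j o => if rho j.1 == j.2 then b j o else a j o)).
  by rewrite big1 // => j _; case: (_ == _).
have Z0 : (0 < #|{ffun K -> L}|)%N by rewrite card_ffun expn_gt0 L0.
pose S := (\sum_j x j) / #|L|%:R ^+ 2.
have x0 j : 0 <= x j by rewrite sumr_ge0 // => o _; rewrite divr_ge0 ?sqr_ge0.
have S0 : 0 <= S by apply: divr_ge0; [apply: sumr_ge0|apply: sqr_ge0].
have in01 (c : {ffun K * L -> P} -> R) : (forall o, 0 <= c o) -> \sum_o c o = 1 ->
    0 <= \sum_o c o * H o <= 1.
  move=> c0 c1; apply/andP; split.
    by rewrite sumr_ge0 // => o _; have /andP[? ?] := H01 o; rewrite mulr_ge0.
  by rewrite -c1 ler_sum // => o _; have /andP[? ?] := H01 o; rewrite ler_piMr.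
(* If [S > 1 / 2], then [S / alpha >= 1] and the bound is trivial for a difference of two
   probabilities. *)
rewrite -/S; have [S2|S2] := leP S (1 / 2); last first.
  have /andP[l0 l1] := in01 A A0 A1.
  have m0 : 0 <= avg (fun rho => \sum_o A o * f rho o * H o).
    by apply: avg_ge0 => rho; have /andP[] := in01 _ (Af0 rho) (Af1 rho).
  have m1 : avg (fun rho => \sum_o A o * f rho o * H o) <= 1.
    rewrite -(avg_cst 1 Z0); apply: ler_avg => rho.
    by have /andP[] := in01 _ (Af0 rho) (Af1 rho).
  have Sal : 1 <= S / alpha by rewrite ler_pdivlMr // mul1r; lra.
  by rewrite ler_norml; lra.
apply: le_trans (second_moment al0 Z0 A0 A1 H01 Af1) _.
rewrite lerD2l.
(* In group [k] the two copies agree with probability [1 / #|L|], at a uniform place; both facts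
   together put the mean of [x (k, _)] over [#|L|]. *)
have -> : avg (fun z => avg (fun z' => \sum_o A o * (f z o * f z' o))) =
    \prod_k (1 + (\sum_i x (k, i)) / #|L|%:R ^+ 2).
  have E (z z' : {ffun K -> L}) : \sum_o A o * (f z o * f z' o) =
      \prod_k (1 + (z k == z' k)%:R * x (k, z k)).
    pose g (j : K * L) (o : P) := a j o * ((if z j.1 == j.2 then 1 + u j o else 1) *
       (if z' j.1 == j.2 then 1 + u j o else 1)).
    transitivity (\sum_(o : {ffun K * L -> P}) \prod_j g j (o j)).
      by apply: eq_bigr => o _; rewrite -!big_split.
    have au0 j : \sum_o a j o * u j o = 0.
      have : \sum_o (a j o * (1 + u j o)) = 1.
        by under eq_bigr do rewrite auE.
      under eq_bigr do rewrite mulrDr mulr1.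
      by rewrite big_split /= a1; lra.
    have au1 j : \sum_o a j o * (1 + u j o) = 1 by under eq_bigr do rewrite auE.
    rewrite sum_ffun_prod.
    transitivity (\prod_(j : K * L)
        (1 + ((z j.1 == j.2) && (z' j.1 == j.2))%:R * x j)).
      apply: eq_bigr => j _; rewrite /g; case: (z j.1 == j.2); case: (z' j.1 == j.2) => /=.
      - rewrite mul1r.
        have -> : 1 + x j = \sum_o a j o + 2 * (\sum_o a j o * u j o)
            + \sum_o a j o * u j o ^+ 2.
          by rewrite a1 au0 mulr0 addr0; under [X in _ = 1 + X]eq_bigr do rewrite auuE.
        rewrite big_distrr -!big_split /=; apply: eq_bigr => o _; ring.
      - by rewrite mul0r addr0 -[RHS](au1 j); apply: eq_bigr => o _; rewrite mulr1.
      - by rewrite mul0r addr0 -[RHS](au1 j); apply: eq_bigr => o _; rewrite mul1r.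
      - by rewrite mul0r addr0 -[RHS](a1 j); apply: eq_bigr => o _; rewrite !mulr1.
    rewrite big_pairE; apply: eq_bigr => k _; rewrite (bigD1 (z k)) //= eqxx /= big1 ?mulr1.
      by rewrite eq_sym.
    by move=> i; rewrite eq_sym => /negPf ->; rewrite mul0r addr0.
  under eq_avg do under eq_avg do rewrite E.
  transitivity (avg (fun z : {ffun K -> L} => \prod_k (1 + x (k, z k) / #|L|%:R))).
    apply: eq_avg => z.
    rewrite (avg_ffun_prod (fun k i => 1 + (z k == i)%:R * x (k, z k))).
    apply: eq_bigr => k _; rewrite avgD avg_cst // avgZr; congr (1 + _).
    rewrite mulrC; congr (_ * _); rewrite /avg (bigD1 (z k)) //= eqxx big1 ?addr0 ?mul1r //.
    by move=> i; rewrite eq_sym => /negPf ->.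
  rewrite (avg_ffun_prod (fun k i => 1 + x (k, i) / #|L|%:R)).
  apply: eq_bigr => k _; rewrite avgD avg_cst // avgZr /avg.
  by rewrite -mulrA expr2 invfM.
have SE : \sum_k (\sum_i x (k, i)) / #|L|%:R ^+ 2 = S.
  by rewrite /S big_pairE big_distrl.
have := @prod_1D_le R K (fun k => (\sum_i x (k, i)) / #|L|%:R ^+ 2).
rewrite SE => /(_ _ S2) h.
rewrite [(2 * alpha)^-1]invfM mulrA ler_wpM2r ?invr_ge0 ?(ltW al0) //.
rewrite ler_pdivrMr ?ltr0n // mulrC; apply: h => k.
by apply: divr_ge0; [apply: sumr_ge0|apply: sqr_ge0].
Qed.

(** * The order of the samples in a block *)

Lemma lt_lex (s a b a' b' : nat) : (b < s)%N -> (b' < s)%N ->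
  (a * s + b < a' * s + b')%N = (a < a')%N || ((a == a') && (b < b')%N).
Proof.
move=> bs bs'; case: (ltngtP a a') => [aa'|aa'|->] /=; last by rewrite ltn_add2l.
  have : (a.+1 * s <= a' * s)%N by rewrite leq_mul2r aa' orbT.
  by rewrite mulSn => h; apply/idP; lia.
have : (a'.+1 * s <= a * s)%N by rewrite leq_mul2r aa' orbT.
by rewrite mulSn => h; apply/negbTE; lia.
Qed.

(** List each set followed by its complement, and match the two lists position by position. *)
Lemma perm_of_card_eq (T : finType) (A B : {set T}) : #|A| = #|B| ->
  exists phi : T -> T, bijective phi /\ forall x, (phi x \in B) = (x \in A).
Proof.
move=> AB; pose e (X : {set T}) := enum X ++ enum (~: X).
have eU X : uniq (e X).
  rewrite cat_uniq !enum_uniq andbT /=; apply/hasPn => x.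
  by rewrite !mem_enum inE.
have inE' X x : x \in e X by rewrite mem_cat !mem_enum inE orbN.
have sizeE X : size (e X) = #|T| by rewrite size_cat -!cardE cardsC.
pose phi x := nth x (e B) (index x (e A)).
have phi_lt x : (index x (e A) < size (e B))%N.
  by rewrite sizeE -(sizeE A) index_mem.
exists phi; split.
  apply: injF_bij => x y; rewrite /phi (set_nth_default x y) // => /eqP.
  by rewrite nth_uniq // => /eqP; apply: index_inj.
move=> x; rewrite /phi index_cat mem_enum; case: ifPn => xA; rewrite nth_cat -cardE -AB cardE.
  by rewrite index_mem mem_enum xA -mem_enum mem_nth // -cardE -AB cardE index_mem mem_enum.
rewrite ltnNge leq_addr /= addKn; apply/negbTE; rewrite -in_setC -mem_enum mem_nth //.
have cAB : #|~: A| = #|~: B| by rewrite (cardsCs (~: A)) (cardsCs (~: B)) !setCK AB.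
by rewrite -cardE -cAB cardE index_mem mem_enum inE.
Qed.

Definition seed (D s : nat) : predArgType := 'I_D * 'I_s.

(* A cell consists of three thirds of length [s]. Samples lie in the middle third,
   except those of [q] in the first [L] cells of a selected block, which the seed
   sends to the left or to the right third. *)
Definition inner (L h D s : nat) (sel q : bool) (t : seed D s) : nat :=
  if [&& sel, q & (t.1 < L)%N] then (if (h <= t.2)%N then 2 else 0) else 1.

Definition loc (L h D s : nat) (sel q : bool) (t : seed D s) : nat :=
  ((t.1 * 3 + inner L h sel q t) * s + t.2)%N.

(* Samples [i < n] come from [p], the others from [q]; adding [i] breaks ties. *)
Definition key (n L h m D s : nat) (sel : bool) (i : 'I_m) (t : seed D s) : nat :=
  (loc L h sel (n <= i)%N t * m + i)%N.

(** Making every comparison outside [S] false turns the pattern of a block into a function of the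
    seeds of its own samples. *)
Definition opat (m : nat) (S : {set 'I_m}) (y : 'I_m -> nat) : pattern m :=
  [ffun ij => [&& ij.1 \in S, ij.2 \in S & (y ij.1 < y ij.2)%N]].

Definition blockpat (n L h m D s : nat) (sel : bool) (S : {set 'I_m})
    (w : {ffun 'I_m -> seed D s}) : pattern m :=
  opat S (fun i => key n L h sel i (w i)).

Lemma inner_lt3 L h D s sel q (t : seed D s) : (inner L h sel q t < 3)%N.
Proof. by rewrite /inner; case: ifP => // _; case: ifP. Qed.

Lemma key_lt n L h m D s sel (i j : 'I_m) (t t' : seed D s) :
  (key n L h sel i t < key n L h sel j t')%N =
  (t.1 < t'.1)%N || (t.1 == t'.1) &&
    ((inner L h sel (n <= i)%N t < inner L h sel (n <= j)%N t')%N ||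
     (inner L h sel (n <= i)%N t == inner L h sel (n <= j)%N t') &&
       ((t.2 < t'.2)%N || (t.2 == t'.2) && (i < j)%N)).
Proof.
rewrite /key lt_lex // /loc.
have eqlex (a b c d e : nat) : (b < e)%N -> (d < e)%N ->
    (a * e + b == c * e + d)%N = (a == c) && (b == d).
  move=> be de; rewrite [LHS]eqn_leq (leqNgt (a * e + b)) (leqNgt (c * e + d)) !lt_lex //.
  by case: (ltngtP a c); case: (ltngtP b d).
rewrite (@lt_lex s) // (eqlex _ _ _ _ s) // (@lt_lex 3) ?inner_lt3 //.
rewrite (eqlex _ _ _ _ 3) ?inner_lt3 //.
rewrite !val_eqE.
case: (t.1 < t'.1)%N => //=; case: (t.1 == t'.1) => //=.
case: ltngtP => //=.
Qed.

(* With [s = 2 h + 1] both sides are [s (s + 1) / 2]: this is why the thirds of a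
   cell have odd length. *)
Lemma card_le_pairs h :
  #|[set v : 'I_h.*2.+1 * 'I_h.*2.+1 | (v.1 <= v.2)%N]| =
  #|[set v : 'I_h.*2.+1 * 'I_h.*2.+1 | (h <= v.2)%N]|.
Proof.
set s := h.*2.+1.
have cardpair (P : 'I_s -> 'I_s -> bool) :
    #|[set v : 'I_s * 'I_s | P v.1 v.2]| = (\sum_(y < s) \sum_(x < s) P x y)%N.
  rewrite -sum1dep_card big_mkcond /= big_pairE exchange_big /=.
  by apply: eq_bigr => y _; apply: eq_bigr => x _; case: (P x y).
rewrite (cardpair (fun x y => x <= y)%N) (cardpair (fun _ y => h <= y)%N).
have le_cnt y k : (\sum_(x < k) (x <= y) = minn k y.+1)%N.
  by elim: k => [|k IH]; rewrite ?big_ord0 // big_ord_recr /= IH; lia.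
have ge_cnt k : (\sum_(x < k) (h <= x) = k - h)%N.
  by elim: k => [|k IH]; rewrite ?big_ord0 // big_ord_recr /= IH; lia.
under [RHS]eq_bigr do rewrite sum_nat_const card_ord.
rewrite -big_distrr /= ge_cnt.
rewrite (eq_bigr (fun y : 'I_s => y.+1)) => [|y _]; last first.
  by rewrite le_cnt; apply/minn_idPr.
have tri k : ((\sum_(i < k) i.+1) * 2 = k * k.+1)%N.
  elim: k => [|k IH]; first by rewrite big_ord0.
  by rewrite big_ord_recr /= mulnDl IH; lia.
have := tri s; rewrite /s; set S := (\sum_(i < _) _)%N; nia.
Qed.

(** * The coupling of modified and unmodified blocks *)

Definition partner (n L m D s : nat) (S : {set 'I_m}) (w : {ffun 'I_m -> seed D s})
    (i j : 'I_m) : bool :=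
  [&& i \in S, j \in S, (w i).1 == (w j).1, ((w i).1 < L)%N, (i < n)%N != (j < n)%N &
   [forall l in S, ((w l).1 == (w i).1) ==> (l == i) || (l == j)]].

(* When a cell holds exactly one sample of each distribution, [phi] exchanges the
   event that decides their order in an unmodified cell with the one that decides
   it in a modified cell. *)
Definition couple (n L m D s : nat) (S : {set 'I_m}) (phi : 'I_s * 'I_s -> 'I_s * 'I_s)
    (w : {ffun 'I_m -> seed D s}) : {ffun 'I_m -> seed D s} :=
  [ffun i => if [pick j | partner n L S w i j] is Some j then
     ((w i).1, if (i < n)%N then (phi ((w i).2, (w j).2)).1
               else (phi ((w j).2, (w i).2)).2)
   else w i].

Lemma partner_sym n L m D s S (w : {ffun 'I_m -> seed D s}) i j :
  partner n L S w i j -> partner n L S w j i.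
Proof.
case/and5P => iS jS /eqP dij iL /andP[cij /forallP h]; apply/and5P; split => //.
- by rewrite dij.
- by rewrite -dij.
rewrite eq_sym cij; apply/forallP => l; have := h l.
by rewrite dij orbC.
Qed.

Lemma partner_uniq n L m D s S (w : {ffun 'I_m -> seed D s}) i j l :
  partner n L S w i j -> partner n L S w i l -> l = j.
Proof.
case/and5P => iS jS /eqP dij iL /andP[cij /forallP h].
case/and5P => _ lS /eqP dil _ /andP[cil _].
have := h l; rewrite lS dil eqxx /= => /orP[/eqP li|/eqP //].
by rewrite li eqxx in cil.
Qed.

Lemma pick_partner n L m D s S (w : {ffun 'I_m -> seed D s}) i j :
  partner n L S w i j -> [pick j | partner n L S w i j] = Some j.
Proof.
move=> pij; case: pickP => [l pil|/(_ j)]; last by rewrite pij.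
by rewrite (partner_uniq pij pil).
Qed.

Lemma couple1 n L m D s S phi (w : {ffun 'I_m -> seed D s}) i :
  (couple n L S phi w i).1 = (w i).1.
Proof. by rewrite ffunE; case: pickP. Qed.

Lemma partner_couple n L m D s S phi (w : {ffun 'I_m -> seed D s}) i j :
  partner n L S (couple n L S phi w) i j = partner n L S w i j.
Proof.
rewrite /partner !couple1; do 5!congr (_ && _).
by apply: eq_forallb => l; rewrite couple1.
Qed.

Lemma couple_partner n L m D s S phi (w : {ffun 'I_m -> seed D s}) (i j : 'I_m) :
  partner n L S w i j -> (i < n)%N ->
  ((couple n L S phi w i).2, (couple n L S phi w j).2) = phi ((w i).2, (w j).2).
Proof.
move=> pij i_n; rewrite !ffunE (pick_partner pij) (pick_partner (partner_sym pij)) /= i_n.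
have /negPf -> : ~~ (j < n)%N.
  by case/and5P: pij => _ _ _ _ /andP[]; rewrite i_n; case: (j < n)%N.
by rewrite -surjective_pairing.
Qed.

(** [couple] moves no sample to another cell and [partner] depends on the cells alone, so both maps
    act on the same pairs. *)
Lemma coupleK n L m D s (S : {set 'I_m}) (phi psi : 'I_s * 'I_s -> 'I_s * 'I_s) :
  cancel phi psi ->
  cancel (@couple n L m D s S phi) (@couple n L m D s S psi).
Proof.
move=> phiK w; apply/ffunP => i.
have pairE (t t' : seed D s) : t.1 = t'.1 -> t.2 = t'.2 -> t = t'.
  by case: t t' => [? ?] [? ?] /= -> ->.
apply: pairE; first by rewrite !couple1.
have pairK (a b : 'I_m) : partner n L S w a b -> (a < n)%N ->
   ((couple n L S psi (couple n L S phi w) a).2,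
    (couple n L S psi (couple n L S phi w) b).2) = ((w a).2, (w b).2).
  move=> pab a_n; rewrite (@couple_partner _ _ _ _ _ _ psi) ?partner_couple //.
  by rewrite (couple_partner _ pab a_n) phiK.
case: (pickP (partner n L S w i)) => [j pij|no_p].
  have [i_n|ni_n] := boolP (i < n)%N; first by have [] := pairK _ _ pij i_n.
  have jn : (j < n)%N.
    by case/and5P: pij => _ _ _ _ /andP[]; rewrite (negPf ni_n); case: (j < n)%N.
  by have [] := pairK _ _ (partner_sym pij) jn.
rewrite ffunE; case: pickP => [j|_]; first by rewrite partner_couple no_p.
by rewrite ffunE; case: pickP => [j|//]; rewrite no_p.
Qed.

Lemma couple_bij n L m D s (S : {set 'I_m}) (phi : 'I_s * 'I_s -> 'I_s * 'I_s) :
  bijective phi -> bijective (@couple n L m D s S phi).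
Proof. by case=> psi phiK psiK; exists (couple n L S psi); apply: coupleK. Qed.

Definition collision (L m D s : nat) (w : {ffun 'I_m -> seed D s}) (i j l : 'I_m) : bool :=
  [&& i != j, i != l, j != l, (w i).1 == (w j).1, (w i).1 == (w l).1 & ((w i).1 < L)%N].

Definition triple_free (L m D s : nat) (S : {set 'I_m}) (w : {ffun 'I_m -> seed D s}) : bool :=
  [forall i in S, forall j in S, forall l in S, ~~ collision L w i j l].

(** Different cells compare by cell, which the coupling preserves. Without triples, a modified cell
    holding [i] and [j] holds nothing else of [S], so only the origin of these two samples
    matters. *)
Lemma blockpat_couple n L h m D s (S : {set 'I_m}) (phi : 'I_s * 'I_s -> 'I_s * 'I_s)
    (w : {ffun 'I_m -> seed D s}) :
  (forall v, (h <= (phi v).2)%N = (v.1 <= v.2)%N) -> triple_free L S w ->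
  blockpat n L h true S (couple n L S phi w) = blockpat n L h false S w.
Proof.
move=> phiP tf; apply/ffunP => -[i j]; rewrite [LHS]ffunE [RHS]ffunE /=.
case: (boolP (i \in S)) => //= iS; case: (boolP (j \in S)) => //= jS.
rewrite !key_lt !couple1 -(val_eqE (w i).1) /=.
case: (ltngtP (w i).1 (w j).1) => //= /val_inj dij.
have [<-|nij] := eqVneq i j; first by rewrite !ltnn !andbF.
have [jL|Lj] := ltnP (w j).1 L; last first.
  have nopart (a b : 'I_m) : (w a).1 = (w j).1 -> ~~ partner n L S w a b.
    by move=> da; rewrite /partner da [(_ < L)%N]ltnNge Lj /= !andbF.
  have same (a : 'I_m) : (w a).1 = (w j).1 -> couple n L S phi w a = w a.
    move=> da; rewrite ffunE; case: pickP => // b pab.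
    by have := nopart a b da; rewrite pab.
  by rewrite !same // /inner dij [((w j).1 < L)%N]ltnNge Lj /= !andbF.
have only (l : 'I_m) : l \in S -> (w l).1 = (w j).1 -> (l == i) || (l == j).
  move=> lS dl; apply/negPn; rewrite negb_or; apply/negP => /andP[li lj].
  have /forallP/(_ i)/implyP/(_ iS)/forallP/(_ j)/implyP/(_ jS)/forallP/(_ l)/implyP/(_ lS) := tf.
  by rewrite /collision nij [i == l]eq_sym li [j == l]eq_sym lj dij dl eqxx jL.
(* Both from [p]: nothing moves. Both from [q]: the side is a monotone function of the offset, so
   their order does not change. The coupling leaves such samples alone. *)
have [cij|cij] := eqVneq (i < n)%N (j < n)%N.
  have nopart (a b : 'I_m) : (a == i) || (a == j) -> ~~ partner n L S w a b.
    move=> aij; apply/negP => /and5P[aS bS /eqP dab aL /andP[cab _]].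
    have da : (w a).1 = (w j).1 by case/orP: aij => /eqP ->.
    move: cab; have := only b bS (etrans (esym dab) da).
    by case/orP: aij => /eqP ->; case/orP => /eqP ->; rewrite ?cij eqxx.
  have same (a : 'I_m) : (a == i) || (a == j) -> couple n L S phi w a = w a.
    move=> da; rewrite ffunE; case: pickP => // b pab.
    by have := nopart a b da; rewrite pab.
  rewrite !same ?eqxx ?orbT // /inner dij jL /= (leqNgt n i) (leqNgt n j) cij !andbT.
  case: (j < n)%N => //=; rewrite -val_eqE /=.
  case: (leqP h (w i).2) => hi; case: (leqP h (w j).2) => hj //=; case: ltngtP => //=; lia.
(* One from each: in a modified cell the [p]-sample comes first iff the [q]-sample goes right,
   [h <= v.2]; in an unmodified one iff [v.1 <= v.2], ties going to [p] because its index is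
   smaller. The assumption on [phi] equates the two. *)
have pij : partner n L S w i j.
  apply/and5P; split; rewrite ?iS ?jS ?dij // cij /=.
  by apply/forallP => l; apply/implyP => lS; apply/implyP => /eqP; apply: only.
have [i_n|ni_n] := ltnP i n.
  have jn : (n <= j)%N by move: cij; rewrite i_n; case: ltnP.
  have := couple_partner phi pij i_n; have := phiP ((w i).2, (w j).2).
  rewrite /inner; case: (phi _) => v1 v2 /= h2 [-> ->].
  rewrite !couple1 ?dij jL jn /= h2 -(val_eqE (w i).2) /=.
  have ij : (i < j)%N by apply: leq_trans jn.
  by rewrite ij; case: (ltngtP (w i).2 (w j).2).
have jn : (j < n)%N by move: cij; rewrite ltnNge ni_n; case: ltnP.
have := couple_partner phi (partner_sym pij) jn; have := phiP ((w j).2, (w i).2).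
rewrite /inner; case: (phi _) => v1 v2 /= h2 [-> ->].
rewrite !couple1 ?dij jL [(n <= j)%N]leqNgt jn /= h2 -(val_eqE (w i).2) /=.
have ij : (j < i)%N by apply: leq_trans ni_n.
by rewrite [(i < j)%N]ltnNge (ltnW ij); case: (ltngtP (w i).2 (w j).2).
Qed.

(** * Laws of the pattern of a block, given the set of its samples *)

Definition law (R : realFieldType) (n L h m D s : nat) (sel : bool) (S : {set 'I_m})
    (o : pattern m) : R :=
  avg (fun w : {ffun 'I_m -> seed D s} => (blockpat n L h sel S w == o)%:R).

Lemma law_ge0 (R : realFieldType) n L h m D s sel (S : {set 'I_m}) o :
  0 <= law R n L h D s sel S o.
Proof. by apply: avg_ge0 => w; rewrite ler0n. Qed.

Lemma law_sum (R : realFieldType) n L h m D s sel (S : {set 'I_m}) (f : pattern m -> R) :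
  \sum_o law R n L h D s sel S o * f o =
  avg (fun w : {ffun 'I_m -> seed D s} => f (blockpat n L h sel S w)).
Proof.
under eq_bigr do rewrite /law -avgZr.
rewrite -avg_sum; apply: eq_avg => w.
rewrite (bigD1 (blockpat n L h sel S w)) //= eqxx mul1r big1 ?addr0 // => o.
by rewrite eq_sym => /negPf ->; rewrite mul0r.
Qed.

Lemma card_seed_ffun m D s : (0 < D)%N -> (0 < s)%N -> (0 < #|{ffun 'I_m -> seed D s}|)%N.
Proof. by move=> D0 s0; rewrite card_ffun expn_gt0 card_prod !card_ord muln_gt0 D0 s0. Qed.

Lemma law1 (R : realFieldType) n L h m D s sel (S : {set 'I_m}) :
  (0 < D)%N -> (0 < s)%N -> \sum_o law R n L h D s sel S o = 1.
Proof.
move=> D0 s0; under eq_bigr do rewrite -[law _ _ _ _ _ _ _ _ _]mulr1.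
by rewrite (law_sum _ _ _ _ _ _ _ (fun=> 1)) avg_cst // card_seed_ffun.
Qed.

(** Three distinct samples meet in a given cell with probability [1 / D^3], and at most [L] cells
    count. *)
Lemma avg_collision (R : realFieldType) L m D s (i j l : 'I_m) :
  (0 < D)%N -> (0 < s)%N ->
  avg (fun w : {ffun 'I_m -> seed D s} => (collision L w i j l)%:R) <=
  L%:R / D%:R ^+ 3 :> R.
Proof.
move=> D0 s0.
have rhs0 : 0 <= L%:R / D%:R ^+ 3 :> R by rewrite divr_ge0 // exprn_ge0.
have [/and3P[ij il jl]|ndist] := boolP [&& i != j, i != l & j != l]; last first.
  rewrite (@eq_avg _ _ _ (fun=> 0)) => [|w]; first by rewrite avg_cst ?card_seed_ffun.
  move: ndist; rewrite /collision.
  by case: (i != j); case: (i != l); case: (j != l).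
pose T3 := [set i; j; l].
pose g (d : 'I_D) (a : 'I_m) (t : seed D s) : R := if a \in T3 then (t.1 == d)%:R else 1.
rewrite (@eq_avg _ _ _ (fun w : {ffun 'I_m -> seed D s} =>
    \sum_(d : 'I_D | (d < L)%N) \prod_a g d a (w a))) => [|w]; last first.
  have gE d : \prod_a g d a (w a) =
      ((w i).1 == d)%:R * ((w j).1 == d)%:R * ((w l).1 == d)%:R.
    rewrite /g -big_mkcond /= /T3 setUAC -setUA !big_setU1 ?big_set1 ?inE; last 2 first.
    - by rewrite eq_sym.
    - by rewrite negb_or il ij.
    by rewrite [RHS]mulrAC -[RHS]mulrA.
  under eq_bigr do rewrite gE.
  rewrite /collision ij il jl /=.
  have [dL|Ld] := ltnP (w i).1 L; last first.
    rewrite !andbF big1 // => d dL; case: eqVneq => [wd|_]; last by rewrite !mul0r.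
    by move: dL; rewrite -wd ltnNge Ld.
  rewrite andbT (bigD1 (w i).1) //= eqxx mul1r [X in _ + X]big1 ?addr0 => [|d /andP[_]].
    by rewrite [(w j).1 == _]eq_sym [(w l).1 == _]eq_sym -natrM mulnb.
  by rewrite eq_sym => /negPf ->; rewrite !mul0r.
rewrite avg_sum.
under eq_bigr do rewrite (avg_ffun_prod (g _)).
have avg1 (d : 'I_D) : avg (fun t : seed D s => (t.1 == d)%:R) = D%:R^-1 :> R.
  rewrite avg_pair (@eq_avg _ _ _ (fun x => (x == d)%:R)) => [|x]; last by rewrite avg_cst ?card_ord.
  rewrite /avg (bigD1 d) //= eqxx big1 => [|x /negPf -> //].
  by rewrite addr0 mul1r card_ord.
have gavg (d : 'I_D) : \prod_a avg (g d a) = D%:R^-1 ^+ 3.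
  rewrite (eq_bigr (fun a => if a \in T3 then D%:R^-1 else 1)) => [|a _].
    rewrite -big_mkcond /= prodr_const; congr (_ ^+ _).
    by rewrite /T3 setUC cardsU1 !inE cards2 ?ij /= negb_or [l == i]eq_sym [l == j]eq_sym il jl.
  rewrite /g; case: (a \in T3); first exact: avg1.
  by rewrite avg_cst // card_prod !card_ord muln_gt0 D0 s0.
under eq_bigr do rewrite gavg.
rewrite sumr_const -[_ *+ #|_|]mulr_natl exprVn ler_wpM2r ?invr_ge0 ?exprn_ge0 // ler_nat.
rewrite -sum1_card -(big_mkord (fun d => (d < L)%N) (fun=> 1%N)).
have -> k : (\sum_(0 <= d < k | (d < L)%N) 1 = minn k L)%N.
  elim: k => [|k IH]; first by rewrite big_geq ?min0n.
  by rewrite big_mkcond big_nat_recr //= -big_mkcond IH; case: ltnP; lia.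
exact: geq_minr.
Qed.

(** Under the coupling the two patterns differ only in the presence of a triple; the union bound
    over [#|S|^3] triples gives the probability, and the factor 2 passes to the [L^1] distance. *)
Lemma law_dist (R : realFieldType) n L h m D (S : {set 'I_m}) : (0 < D)%N ->
  \sum_o `|law R n L h D h.*2.+1 true S o - law R n L h D h.*2.+1 false S o| <=
  2 * (#|S|%:R ^+ 3 * (L%:R / D%:R ^+ 3)).
Proof.
move=> D0; set s := h.*2.+1.
have [phi [phi_bij phiP]] := perm_of_card_eq (card_le_pairs h).
have phiE v : (h <= (phi v).2)%N = (v.1 <= v.2)%N by have := phiP v; rewrite !inE.
pose W := {ffun 'I_m -> seed D s}.
pose bad (w : W) : R := (~~ triple_free L S w)%:R.
have s0 : (0 < s)%N by [].
apply: (@le_trans _ _ (2 * avg bad)).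
  rewrite -[2 * _]avgZ.
  apply: (@le_trans _ _ (\sum_o avg (fun w : W =>
      `|(blockpat n L h true S (couple n L S phi w) == o)%:R -
        (blockpat n L h false S w == o)%:R|))).
    apply: ler_sum => o _; rewrite /law -(avg_bij _ (couple_bij n L D S phi_bij)) -avgB.
    exact: ler_norm_avg.
  rewrite -avg_sum; apply: ler_avg => w; rewrite /bad.
  case: (boolP (triple_free L S w)) => [tf|_] /=.
    rewrite mulr0 big1 // => o _.
    by rewrite (blockpat_couple _ phiE tf) subrr normr0.
  rewrite mulr1; set o1 := blockpat _ _ _ true _ _; set o2 := blockpat _ _ _ false _ _.
  have one (o' : pattern m) : \sum_o (o' == o)%:R = 1 :> R.
    rewrite (bigD1 o') //= eqxx big1 ?addr0 // => o.
    by rewrite eq_sym => /negPf ->.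
  apply: (@le_trans _ _ (\sum_o ((o1 == o)%:R + (o2 == o)%:R))); last first.
    by rewrite big_split /= !one.
  apply: ler_sum => o _; apply: le_trans (ler_normB _ _) _.
  by rewrite !ger0_norm.
rewrite ler_wpM2l //.
apply: (@le_trans _ _ (avg (fun w : W =>
    \sum_(i in S) \sum_(j in S) \sum_(l in S) (collision L w i j l)%:R))).
  apply: ler_avg => w; rewrite /bad /triple_free.
  have nn (T : finType) (P : pred T) (F : T -> R) : (forall x, 0 <= F x) ->
      0 <= \sum_(x | P x) F x by move=> F0; apply: sumr_ge0.
  case: forallP => /= [_|/forallP]; first by rewrite !nn // => i; rewrite !nn // => j; rewrite nn.
  rewrite negb_forall => /existsP[i]; rewrite negb_imply => /andP[iS].
  rewrite negb_forall => /existsP[j]; rewrite negb_imply => /andP[jS].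
  rewrite negb_forall => /existsP[l]; rewrite negb_imply negbK => /andP[lS col].
  rewrite (bigD1 i) //= (bigD1 j) //= (bigD1 l) //= col -!addrA lerDl.
  by rewrite !addr_ge0 ?nn // => i'; rewrite !nn // => j'; rewrite nn.
rewrite avg_sum.
have -> : #|S|%:R ^+ 3 * (L%:R / D%:R ^+ 3) =
    \sum_(i in S) \sum_(j in S) \sum_(l in S) (L%:R / D%:R ^+ 3 : R).
  by rewrite !sumr_const -!mulrnA -[RHS]mulr_natl !natrM -!mulrA.
apply: ler_sum => i _; rewrite avg_sum; apply: ler_sum => j _.
by rewrite avg_sum; apply: ler_sum => l _; apply: avg_collision.
Qed.

Lemma rank_lt (m : nat) (S : {set 'I_m}) (y : 'I_m -> nat) (i j : 'I_m) :
  i \in S -> (y i < y j)%N ->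
  (#|[set a in S | (y a < y i)%N]| < #|[set a in S | (y a < y j)%N]|)%N.
Proof.
move=> iS ij; apply: proper_card; apply/properP; split.
  by apply/fintype.subsetP => a; rewrite !inE => /andP[-> ai]; rewrite (ltn_trans ai ij).
by exists i; rewrite !inE iS ?ij ?ltnn.
Qed.

(* A prescribed order [y] on [S] is realized as soon as the sample of rank [r]
   falls into the [r]-th of [#|S|] consecutive segments of equal length. *)
Lemma law_lower (R : realFieldType) n L h m D s (S : {set 'I_m}) (y : 'I_m -> nat) :
  injective y -> (0 < D)%N -> (0 < s)%N -> (m <= s)%N ->
  (((2 * #|S|) ^ #|S|)%N%:R)^-1 <= law R n L h D s false S (opat S y).
Proof.
move=> yI D0 s0 ms; set t := #|S|.
pose rk i := #|[set a in S | (y a < y i)%N]|.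
pose q := (D * s %/ t)%N.
pose z (u : seed D s) := (u.1 * s + u.2)%N.
pose W i : {set seed D s} := if i \in S then [set u | (rk i * q <= z u < (rk i).+1 * q)%N] else setT.
have tm : (t <= m)%N by rewrite -[leqRHS]card_ord max_card.
have real (w : {ffun 'I_m -> seed D s}) : (forall i, w i \in W i) ->
    blockpat n L h false S w = opat S y.
  move=> wW; apply/ffunP => -[i j]; rewrite !ffunE /=.
  case: (boolP (i \in S)) => //= iS; case: (boolP (j \in S)) => //= jS.
  have zlt a b : a \in S -> b \in S -> (y a < y b)%N ->
      (key n L h false a (w a) < key n L h false b (w b))%N.
    move=> aS bS ab; have rab : (rk a < rk b)%N by apply: rank_lt.
    have := wW a; have := wW b; rewrite /W aS bS !inE => /andP[zb _] /andP[_ za].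
    have zz : (z (w a) < z (w b))%N.
      by apply: leq_trans za (leq_trans _ zb); rewrite leq_mul2r rab orbT.
    rewrite key_lt /inner /= -val_eqE -(val_eqE (w a).2) /=.
    by move: zz; rewrite /z lt_lex // => /orP[->//|/andP[-> ->]]; rewrite orbT.
  case: (ltngtP (y i) (y j)) => yij.
  - by rewrite zlt.
  - by apply/negbTE; rewrite -leqNgt ltnW // zlt.
  - by rewrite (yI _ _ yij) ltnn.
apply: (@le_trans _ _ (avg (fun w : {ffun 'I_m -> seed D s} => \prod_i (w i \in W i)%:R))); last first.
  apply: ler_avg => w; case: (boolP [forall i, w i \in W i]) => [/forallP wW|].
    by rewrite (real w wW) eqxx big1 // => i _; rewrite wW.
  by rewrite negb_forall => /existsP[i /negPf wi]; rewrite (bigD1 i) //= wi mul0r ler0n.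
rewrite (avg_ffun_prod (fun i u => (u \in W i)%:R)).
have avgW i : avg (fun u => (u \in W i)%:R) = #|W i|%:R / (D * s)%:R :> R.
  by rewrite /avg card_prod !card_ord -natr_sum -big_mkcond sum1_card.
have prodE : ((2 * t) ^ t)%N%:R^-1 = \prod_i (if i \in S then (2 * t)%:R^-1 else 1) :> R.
  by rewrite -big_mkcond prodr_const natrX exprVn.
rewrite prodE; apply: ler_prod => i _; rewrite avgW /W; case: ifP => iS; last first.
  rewrite ler01 cardsT card_prod !card_ord divff ?lexx //.
  by rewrite pnatr_eq0 -lt0n muln_gt0 D0.
rewrite invr_ge0 ler0n /=.
have t0 : (0 < t)%N by apply/card_gt0P; exists i.
have ts : (t <= D * s)%N by rewrite (leq_trans tm) // (leq_trans ms) // leq_pmull.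
have rt : (rk i < t)%N.
  apply: proper_card; apply/properP; split;
    [by apply/fintype.subsetP => a; rewrite inE => /andP[]|].
  by exists i; rewrite ?inE ?ltnn ?andbF.
have zDs (k : 'I_q) : (rk i * q + k < D * s)%N.
  apply: (@leq_trans (t * q)); last by rewrite mulnC leq_trunc_div.
  by apply: (@leq_trans ((rk i).+1 * q)); rewrite ?leq_mul2r ?rt ?orbT // mulSn addnC ltn_add2r.
have p1 (k : 'I_q) : ((rk i * q + k) %/ s < D)%N by rewrite ltn_divLR.
have p2 (k : 'I_q) : ((rk i * q + k) %% s < s)%N by rewrite ltn_mod.
pose f (k : 'I_q) : seed D s := (Ordinal (p1 k), Ordinal (p2 k)).
have zf k : z (f k) = (rk i * q + k)%N by rewrite /z /= -divn_eq.
have fI : injective f.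
  by move=> k k' /(congr1 z); rewrite !zf => /addnI /val_inj.
have qW : (q <= #|[set u : seed D s | (rk i * q <= z u < (rk i).+1 * q)%N]|)%N.
  rewrite -[q in (q <= _)%N]card_ord -(card_imset predT fI); apply/subset_leq_card/fintype.subsetP => u.
  by case/imsetP => k _ ->; rewrite inE zf leq_addr /= mulSn addnC ltn_add2r.
apply: (@le_trans _ _ (q%:R / (D * s)%:R)); last first.
  by rewrite ler_wpM2r ?invr_ge0 ?ler0n // ler_nat.
(* Rounding the segment length down costs at most a factor 2: [q >= 1] gives
   [D s < (q + 1) t <= 2 q t]. *)
rewrite ler_pdivlMr ?ltr0n ?muln_gt0 ?D0 // mulrC ler_pdivrMr ?ltr0n ?muln_gt0 ?t0 //.
rewrite -natrM ler_nat.
have q1 : (0 < q)%N by rewrite divn_gt0.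
have : (D * s < q.+1 * t)%N by rewrite -ltn_divLR.
nia.
Qed.

Lemma key_inj n L h m D s sel (w : {ffun 'I_m -> seed D s}) :
  injective (fun i => key n L h sel i (w i)).
Proof.
move=> i j /(congr1 (modn^~ m)); rewrite /key !modnMDl !modn_small //.
exact: val_inj.
Qed.

(** Keys never tie, so every pattern of positive probability is one to which [law_lower] applies. *)
Lemma law_neq0 (R : realFieldType) n L h m D s sel (S : {set 'I_m}) o :
  law R n L h D s sel S o != 0 -> exists2 y, injective y & o = opat S y.
Proof.
move=> lo; case: (pickP (fun w : {ffun 'I_m -> seed D s} => blockpat n L h sel S w == o)).
  by move=> w /eqP <-; exists (fun i => key n L h sel i (w i)) => //; apply: key_inj.
move=> no; case/eqP: lo; rewrite /law /avg big1 ?mul0r // => w _.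
by rewrite no.
Qed.

Lemma law_abs_cont (R : realFieldType) n L h m D s (S : {set 'I_m}) o :
  (0 < D)%N -> (0 < s)%N -> (m <= s)%N ->
  law R n L h D s false S o = 0 -> law R n L h D s true S o = 0.
Proof.
move=> D0 s0 ms lf; apply/eqP; apply: contraPT lf => /law_neq0[y yI ->].
apply/eqP; rewrite gt_eqF //; apply: lt_le_trans (law_lower _ _ _ _ _ yI D0 s0 ms).
by rewrite invr_gt0 ltr0n expn_gt0; case: #|S| => //= k; rewrite muln_gt0.
Qed.

Lemma sum_sqr_le (R : realFieldType) (T : finType) (d : T -> R) :
  \sum_x d x ^+ 2 <= (\sum_x `|d x|) ^+ 2.
Proof.
rewrite [leRHS]expr2 big_distrl /=; apply: ler_sum => x _.
rewrite -[d x ^+ 2]real_normK ?num_real // expr2 ler_wpM2l //.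
by rewrite (bigD1 x) //= lerDl sumr_ge0.
Qed.

(** Each denominator is at least [(2 #|S|)^-#|S|] by [law_lower], and the sum of the squares is at
    most the square of the [L^1] distance. *)
Lemma law_chi2 (R : realFieldType) n L h m D (S : {set 'I_m}) :
    (0 < D)%N -> (m <= h.*2.+1)%N ->
  \sum_o (law R n L h D h.*2.+1 true S o - law R n L h D h.*2.+1 false S o) ^+ 2 /
    law R n L h D h.*2.+1 false S o <=
  ((2 * #|S|) ^ #|S|)%:R * (2 * (#|S|%:R ^+ 3 * (L%:R / D%:R ^+ 3))) ^+ 2.
Proof.
move=> D0 ms; set W : R := (_ ^ _)%:R.
have W0 : 0 < W by rewrite ltr0n expn_gt0; case: #|S| => //= k; rewrite muln_gt0.
apply: (@le_trans _ _ (W * (\sum_o `|law R n L h D h.*2.+1 true S o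
    - law R n L h D h.*2.+1 false S o|) ^+ 2)); last first.
  rewrite ler_wpM2l ?(ltW W0) // ler_pXn2r ?nnegrE ?sumr_ge0 //.
  exact: law_dist.
apply: le_trans (ler_wpM2l (ltW W0) (sum_sqr_le _)).
rewrite big_distrr /=; apply: ler_sum => o _.
have [->|l0] := eqVneq (law R n L h D h.*2.+1 false S o) 0.
  by rewrite invr0 mulr0 mulr_ge0 ?(ltW W0) ?sqr_ge0.
have [y yI oE] := law_neq0 l0.
rewrite mulrC ler_wpM2r ?sqr_ge0 // -[W]invrK lef_pV2 ?posrE ?invr_gt0 //.
  by rewrite oE; apply: law_lower.
by rewrite lt_neqAle eq_sym l0 law_ge0.
Qed.

(** * The number of samples in a block *)

(** The fiber of [j] equals [A] with probability at most that of all of [A] being sent to [j]. *)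
Lemma avg_fiber_le (R : realFieldType) (I J : finType) (j : J) (g : nat -> R) :
  (forall a, 0 <= g a) ->
  avg (fun beta : {ffun I -> J} => g #|[set i | beta i == j]|) <=
  \sum_(A : {set I}) g #|A| / #|J|%:R ^+ #|A|.
Proof.
move=> g0; have J0 : (0 < #|J|)%N by apply/card_gt0P; exists j.
apply: (@le_trans _ _ (avg (fun beta : {ffun I -> J} =>
    \sum_(A : {set I}) g #|A| * \prod_i (if i \in A then (beta i == j)%:R else 1)))).
  apply: ler_avg => beta; rewrite (bigD1 [set i | beta i == j]) //= big1 ?mulr1 => [|i _].
    rewrite lerDl sumr_ge0 // => A _; rewrite mulr_ge0 // prodr_ge0 // => i _.
    by case: ifP; rewrite ?ler0n ?ler01.
  by rewrite inE; case: eqP.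
rewrite avg_sum; apply: ler_sum => A _; rewrite avgZ ler_wpM2l //.
rewrite (avg_ffun_prod (fun i x => if i \in A then (x == j)%:R else 1)).
rewrite -exprVn -prodr_const [X in _ <= X]big_mkcond le_eqVlt; apply/orP; left; apply/eqP.
apply: eq_bigr => i _; case: (i \in A); last by rewrite avg_cst.
by rewrite /avg (bigD1 j) //= eqxx big1 ?addr0 ?mul1r // => x /negPf ->.
Qed.

(** [a^a <= (2 a) (2 a - 1) ... (a + 1) = 'C(2 a, a) * a!], and a binomial coefficient of [2 a] is
    at most [2^(2 a)]. *)
Lemma expn_le_fact a : (a ^ a <= 4 ^ a * a`!)%N.
Proof.
have h1 : (a ^ a <= (a + a) ^_ a)%N.
  rewrite ffact_prod -[X in (a ^ X <= _)%N]card_ord -prod_nat_const.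
  by apply: leq_prod => i _; have := ltn_ord i; lia.
apply: (leq_trans h1); rewrite -bin_ffact leq_mul2r; apply/orP; right.
have := card_draws 'I_(a + a) a; rewrite card_ord => <-.
apply: (leq_trans (max_card _)); rewrite -cardsT -powersetT card_powerset cardsT card_ord.
by rewrite (_ : 4 = 2 ^ 2)%N // -expnM mul2n addnn.
Qed.

Lemma ffact_le_expn m a : (m ^_ a <= m ^ a)%N.
Proof.
rewrite ffact_prod -[X in (_ <= m ^ X)%N]card_ord -prod_nat_const; apply: leq_prod => i _.
exact: leq_subr.
Qed.

(** The weight [(2 a)^a a^6] is the one in [law_chi2], whose squared distance supplies [a^6]. In
    [512 = 2 * 64 * 4] the factors absorb [2^a], [a^6] and the loss in [expn_le_fact]. *)
Lemma bin_weight_le m a :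
  ('C(m, a) * ((2 * a) ^ a * a ^ 6) <= (512 * m) ^ a)%N.
Proof.
have h1 : (a ^ 6 <= 64 ^ a)%N.
  rewrite (_ : 64 = 2 ^ 6)%N // -expnM mulnC expnM leq_exp2r //.
  exact/ltnW/ltn_expl.
have h2 : ('C(m, a) * a ^ a <= 4 ^ a * m ^ a)%N.
  apply: (@leq_trans ('C(m, a) * (4 ^ a * a`!))); first by rewrite leq_mul2l expn_le_fact orbT.
  by rewrite mulnCA bin_ffact leq_mul2l ffact_le_expn orbT.
rewrite (_ : 512 = 2 * 64 * 4)%N // !expnMn.
have -> : ('C(m, a) * (2 ^ a * a ^ a * a ^ 6) = 2 ^ a * a ^ 6 * ('C(m, a) * a ^ a))%N by ring.
have -> : (2 ^ a * 64 ^ a * 4 ^ a * m ^ a = 2 ^ a * 64 ^ a * (4 ^ a * m ^ a))%N by ring.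
by rewrite leq_mul // leq_mul2l h1 orbT.
Qed.

Lemma geometric_le (R : realFieldType) (x : R) k : 0 <= x -> x <= 1 / 2 ->
  \sum_(i < k) x ^+ i.+1 <= 2 * x.
Proof.
move=> x0 x2; suff : \sum_(i < k) x ^+ i.+1 <= 2 * x * (1 - x ^+ k).
  move=> /le_trans -> //; have xk : 0 <= x ^+ k by rewrite exprn_ge0.
  by rewrite ler_piMr ?mulr_ge0 //; lra.
elim: k => [|k IH]; first by rewrite big_ord0 expr0 subrr mulr0.
rewrite big_ord_recr /= exprS; have xk : 0 <= x ^+ k by rewrite exprn_ge0.
move: (x ^+ k) xk IH => y y0 IH.
have : 0 <= x * y * (1 - 2 * x) by rewrite !mulr_ge0 //; lra.
nra.
Qed.

(** Grouping the sets by size leaves a geometric series of ratio [512 m / #|J|], at most [1 / 2] by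
    assumption, so twice its first term bounds it. *)
Lemma avg_fiber_weight (R : realFieldType) m (J : finType) (j : J) :
  (1024 * m <= #|J|)%N ->
  avg (fun beta : {ffun 'I_m -> J} =>
    ((2 * #|[set i | beta i == j]|) ^ #|[set i | beta i == j]| *
       #|[set i | beta i == j]| ^ 6)%:R) <= 1024 * m%:R / #|J|%:R :> R.
Proof.
move=> mJ; have J0 : (0 < #|J|)%N by apply/card_gt0P; exists j.
pose g a : R := ((2 * a) ^ a * a ^ 6)%:R.
have g0 a : 0 <= g a by rewrite ler0n.
apply: (le_trans (@avg_fiber_le R 'I_m J j g g0)).
pose B : R := #|J|%:R; have B0 : 0 < B by rewrite ltr0n.
rewrite -/B (partition_big (fun A : {set 'I_m} => inord #|A| : 'I_m.+1) xpredT) //=.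
apply: (@le_trans _ _ (\sum_(k < m.+1) 'C(m, k)%:R * (g k / B ^+ k))).
  apply: ler_sum => k _.
  rewrite (eq_bigr (fun _ => g k / B ^+ k)) => [|A /eqP <-]; last first.
    by rewrite inordK // ltnS -[leqRHS]card_ord max_card.
  rewrite sumr_const -[_ *+ #|_|]mulr_natl ler_wpM2r ?divr_ge0 ?g0 ?exprn_ge0 ?(ltW B0) //.
  rewrite ler_nat -[m in 'C(m, _)]card_ord -card_draws; apply/subset_leq_card/fintype.subsetP => A.
  rewrite !inE unfold_in => /eqP <-.
  by rewrite -[X in _ == X]/(nat_of_ord _) inordK // ltnS -[leqRHS]card_ord max_card.
(* An empty block contributes nothing, so the bound is proportional to [m / #|J|]. *)
have g00 : g 0%N = 0 by rewrite /g [(0 ^ 6)%N]exp0n // muln0.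
rewrite big_ord_recl [g _]g00 mul0r mulr0 add0r.
pose x : R := 512 * m%:R / B.
have xle : 2 * x <= 1.
  have : 1024 * m%:R <= B by rewrite -natrM ler_nat.
  by rewrite /x mulrA ler_pdivrMr //; lra.
apply: (@le_trans _ _ (\sum_(i < m) x ^+ i.+1)).
  apply: ler_sum => i _; rewrite lift0 /g mulrA -natrM /x expr_div_n.
  by rewrite ler_wpM2r ?invr_ge0 ?exprn_ge0 ?(ltW B0) // -natrM -natrX ler_nat bin_weight_le.
apply: (le_trans (geometric_le _ _ _)).
- by apply: divr_ge0; [rewrite -natrM ler0n|apply: ltW].
- by lra.
- by rewrite /x /B; lra.
Qed.

(** * Reduction to orders *)

Lemma sum_pushforward (R : realFieldType) (I Om T : finType) (f : I -> Om -> T)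
    (F : {ffun I -> T} -> R) :
  \sum_(z : {ffun I -> T}) (\prod_i avg (fun u => (f i u == z i)%:R)) * F z =
  avg (fun w : {ffun I -> Om} => F [ffun i => f i (w i)]).
Proof.
under eq_bigr do rewrite -avg_ffun_prod -avgZr.
rewrite -avg_sum; apply: eq_avg => w.
rewrite (bigD1 [ffun i => f i (w i)]) //= big1 ?mul1r => [|i _]; last by rewrite ffunE eqxx.
rewrite big1 ?addr0 // => z zw.
have [i zi] : exists i, f i (w i) != z i.
  apply/existsP; apply: contraR zw; rewrite negb_exists => /forallP zw.
  by apply/eqP/ffunP => i; rewrite ffunE; apply/esym/eqP; move: (zw i); rewrite negbK.
by rewrite (bigD1 i) //= (negPf zi) !mul0r.
Qed.

Lemma avg_coord (R : realFieldType) (J T : finType) (j : J) (f : T -> R) :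
  (0 < #|T|)%N -> avg (fun g : {ffun J -> T} => f (g j)) = avg f.
Proof.
move=> T0; rewrite (@eq_avg _ _ _ (fun g : {ffun J -> T} =>
    \prod_a (if a == j then f (g a) else 1))) => [|g].
  rewrite (avg_ffun_prod (fun a x => if a == j then f x else 1)) (bigD1 j) //= eqxx.
  by rewrite big1 ?mulr1 // => a /negPf ->; rewrite avg_cst.
by rewrite -big_mkcond big_pred1_eq.
Qed.

Lemma avg_agree (R : realFieldType) (I Om V : finType) (g : Om -> V) (i j : I) :
  i != j -> (0 < #|V|)%N -> (forall a, avg (fun u => (g u == a)%:R) = #|V|%:R^-1 :> R) ->
  avg (fun w : {ffun I -> Om} => (g (w i) == g (w j))%:R) = #|V|%:R^-1 :> R.
Proof.
move=> ij V0 gV.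
have Om0 : (0 < #|Om|)%N.
  have /card_gt0P[a _] := V0; rewrite lt0n; apply/eqP => Om0.
  have := gV a; rewrite /avg Om0 invr0 mulr0 => /esym/eqP.
  by rewrite invr_eq0 pnatr_eq0 -[_ == _]negbK -lt0n V0.
pose h a l (u : Om) : R := if l \in [set i; j] then (g u == a)%:R else 1.
rewrite (@eq_avg _ _ _ (fun w : {ffun I -> Om} => \sum_a \prod_l h a l (w l))) => [|w].
  rewrite avg_sum (eq_bigr (fun=> #|V|%:R^-1 ^+ 2)) => [|a _].
    rewrite sumr_const -[_ *+ #|_|]mulr_natl expr2 mulrA divff ?mul1r //.
    by rewrite pnatr_eq0 -lt0n.
  rewrite (avg_ffun_prod (h a)) (eq_bigr (fun l => if l \in [set i; j] then #|V|%:R^-1 else 1)).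
    by rewrite -big_mkcond prodr_const cards2 ij.
  by move=> l _; rewrite /h; case: (l \in _); rewrite ?gV ?avg_cst.
rewrite (bigD1 (g (w i))) //= [X in _ + X]big1 ?addr0 => [|a ai]; last first.
  by rewrite (bigD1 i) //= /h !inE eqxx [g (w i) == a]eq_sym (negPf ai) mul0r.
rewrite (bigD1 i) //= (bigD1 j) ?[j == i]eq_sym //= /h !inE !eqxx ?orbT mul1r eq_sym.
by rewrite big1 ?mulr1 // => l /andP[/negPf li /negPf lj]; rewrite !inE li lj.
Qed.

(** * Placement of the blocks and the resulting distributions *)

Definition blocks (K r : nat) : predArgType := ('I_K * 'I_r)%type.

Definition block_index (K r : nat) (j : blocks K r) : nat := (j.1 * r + j.2)%N.

Lemma block_index_inj K r : injective (@block_index K r).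
Proof.
move=> [a b] [c d]; rewrite /block_index /= => E.
have r0 : (0 < r)%N by case: r b {d E} => // -[].
have E1 := congr1 (divn^~ r) E; have E2 := congr1 (modn^~ r) E.
rewrite /= !divnMDl // !(divn_small (ltn_ord _)) !addn0 in E1.
rewrite /= !modnMDl !modn_small // in E2.
by rewrite (val_inj E1) (val_inj E2).
Qed.

Lemma block_index_lt K r (j : blocks K r) : (block_index j < K * r)%N.
Proof.
rewrite /block_index; apply: (@leq_trans (j.1.+1 * r)); last by rewrite leq_mul2r ltn_ord orbT.
by rewrite mulSn addnC ltn_add2r.
Qed.

Definition pos (K r D s L h : nat) (sel : blocks K r -> bool) (q : bool)
    (u : blocks K r * seed D s) : nat :=
  (block_index u.1 * (D * 3 * s) + loc L h (sel u.1) q u.2)%N.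

Lemma loc_lt L h D s sel q (t : seed D s) : (loc L h sel q t < D * 3 * s)%N.
Proof.
rewrite /loc; apply: (@leq_trans ((t.1 * 3 + inner L h sel q t).+1 * s)).
  by rewrite mulSn addnC ltn_add2r.
rewrite leq_mul2r; apply/orP; right.
apply: (@leq_trans (t.1.+1 * 3)); last by rewrite leq_mul2r ltn_ord.
by rewrite mulSn addnC ltn_add2r inner_lt3.
Qed.

Lemma pos_lt K r D s L h sel q (u : blocks K r * seed D s) :
  (pos L h sel q u < K * r * (D * 3 * s))%N.
Proof.
rewrite /pos; apply: (@leq_trans ((block_index u.1).+1 * (D * 3 * s))).
  by rewrite mulSn addnC ltn_add2r loc_lt.
by rewrite leq_mul2r block_index_lt orbT.
Qed.

Lemma pos_mod K r D s L h sel q (u : blocks K r * seed D s) :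
  (pos L h sel q u %% s)%N = u.2.2.
Proof. by rewrite /pos /loc mulnA modnMDl modnMDl modn_small. Qed.

Definition cell (K r D s L h : nat) (sel : blocks K r -> bool) (q : bool)
    (u : blocks K r * seed D s) : 'I_(K * r * (D * 3 * s)) :=
  Ordinal (pos_lt L h sel q u).

Definition sample_law (R : realFieldType) (N K r D s L h : nat)
    (e : 'I_(K * r * (D * 3 * s)) -> 'I_N) (sel : blocks K r -> bool) (q : bool) :
    {ffun 'I_N -> R} :=
  [ffun y => avg (fun u : blocks K r * seed D s => (e (cell L h sel q u) == y)%:R)].

(* Each sample carries a private seed for every block, of which only the seed of
   the block it falls into is used; this makes the blocks independent. *)
Lemma sample_law_seeds (R : realFieldType) N K r D s L h e sel q y :
  (0 < D)%N -> (0 < s)%N ->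
  sample_law R L h e sel q y =
  avg (fun u : blocks K r * {ffun blocks K r -> seed D s} =>
         (e (cell L h sel q (u.1, u.2 u.1)) == y :> 'I_N)%:R).
Proof.
move=> D0 s0; rewrite ffunE (@avg_pair _ (blocks K r)) [RHS](@avg_pair _ (blocks K r)).
apply: eq_avg => j /=.
rewrite (avg_coord j (fun t => (e (cell L h sel q (j, t)) == y)%:R)) //.
by rewrite card_prod !card_ord muln_gt0 D0.
Qed.

Definition acceptance (R : realFieldType) (N n : nat) (p q : {ffun 'I_N -> R})
    (F : {ffun 'I_(n + n) -> 'I_N} -> R) : R :=
  \sum_(z : {ffun 'I_(n + n) -> 'I_N})
     (\prod_(i < n + n) (if (i < n)%N then p else q) (z i)) * F z.

(** Acceptance probability of an algorithm that sees only the order, conditioned on the assignment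
    [beta] of samples to blocks: inside a block the pattern follows [law], independently of the
    other blocks, and across blocks [beta] decides. *)
Definition order_acceptance (R : realFieldType) (K r D s L h n : nat)
    (G : pattern (n + n) -> R) (sel : blocks K r -> bool) : R :=
  avg (fun beta : {ffun 'I_(n + n) -> blocks K r} =>
    \sum_(o : {ffun blocks K r -> pattern (n + n)})
      (\prod_j law R n L h D s (sel j) [set i | beta i == j] (o j)) *
      G [ffun ii => if beta ii.1 == beta ii.2 then o (beta ii.1) ii
                    else (block_index (beta ii.1) < block_index (beta ii.2))%N]).

(** The private seeds are regrouped by block instead of by sample ([join]); the order of two samples
    is then read in their common block or between their blocks. *)
Lemma order_acceptanceE (R : realFieldType) (K r D s L h n : nat)
    (G : pattern (n + n) -> R) (sel : blocks K r -> bool) :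
  order_acceptance D s L h G sel =
  avg (fun w : {ffun 'I_(n + n) -> blocks K r * {ffun blocks K r -> seed D s}} =>
    G (pat (fun i => pos L h sel (n <= i)%N ((w i).1, (w i).2 (w i).1) * (n + n) + i)%N)).
Proof.
set m := (n + n)%N; set J := blocks K r; set T := seed D s.
pose join (x : {ffun 'I_m -> J} * {ffun J -> {ffun 'I_m -> T}}) :
   {ffun 'I_m -> J * {ffun J -> T}} := [ffun i => (x.1 i, [ffun j => x.2 j i])].
have join_bij : bijective join.
  exists (fun w : {ffun 'I_m -> J * {ffun J -> T}} =>
    ([ffun i => (w i).1], [ffun j => [ffun i => (w i).2 j]])) => [[x y]|w].
    congr (_, _); apply/ffunP => i; rewrite !ffunE //=.
    by apply/ffunP => j; rewrite !ffunE.
  apply/ffunP => i; rewrite ffunE /=; rewrite [RHS]surjective_pairing !ffunE.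
  by congr (_, _); apply/ffunP => j; rewrite !ffunE.
rewrite -(avg_bij _ join_bij) avg_pair; apply: eq_avg => beta.
rewrite (sum_pushforward (fun j => blockpat n L h (sel j) [set i | beta i == j])
  (fun o => G [ffun ii => if beta ii.1 == beta ii.2 then o (beta ii.1) ii
                    else (block_index (beta ii.1) < block_index (beta ii.2))%N])).
apply: eq_avg => W; congr G; apply/ffunP => -[i i']; rewrite [LHS]ffunE [RHS]ffunE /=.
rewrite !ffunE /= !inE eqxx /=.
have [bb|nbb] := eqVneq (beta i) (beta i').
  by rewrite -bb ?eqxx /= /key /pos /= [LHS]lt_lex // [RHS]lt_lex // ltn_add2l eqn_add2l.
have nb : block_index (beta i) != block_index (beta i').
  by apply: contra_neq nbb; apply: block_index_inj.
rewrite /pos /= lt_lex //; case: ltngtP nb => // [bb|bb] _.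
  by rewrite lt_lex ?loc_lt // bb.
rewrite lt_lex ?loc_lt // [(_ < block_index (beta i'))%N]ltnNge (ltnW bb) gtn_eqF //=.
by rewrite gtn_eqF // lt_lex ?loc_lt // bb.
Qed.

(** [F] and [G] are compared only on distinct samples. Samples with different offsets are distinct,
    two offsets agree with probability [1 / s], and the union bound over pairs gives the second
    term. *)
Lemma order_invariant_acceptance (R : realFieldType) (N K r D s L h n : nat)
    (F : {ffun 'I_(n + n) -> 'I_N} -> R) (G : pattern (n + n) -> R)
    (e : 'I_(K * r * (D * 3 * s)) -> 'I_N) (sel : blocks K r -> bool) (eta : R) :
    (0 < K)%N -> (0 < r)%N -> (0 < D)%N -> (0 < s)%N ->
    0 <= eta -> (forall z, 0 <= F z <= 1) -> (forall o, 0 <= G o <= 1) ->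
    (forall x : 'I_(n + n) -> 'I_(K * r * (D * 3 * s)), injective x ->
       `|F [ffun i => e (x i)] - G (pat (fun i => x i))| <= eta) ->
  `|acceptance (sample_law R L h e sel false) (sample_law R L h e sel true) F
    - order_acceptance D s L h G sel| <= eta + (n + n)%:R ^+ 2 / s%:R.
Proof.
move=> K0 r0 D0 s0 eta0 F01 G01 FG; set m := (n + n)%N in F G F01 G01 FG *.
pose J := blocks K r; pose Om := (J * {ffun J -> seed D s})%type.
pose x (w : {ffun 'I_m -> Om}) (i : 'I_m) := cell L h sel (n <= i)%N ((w i).1, (w i).2 (w i).1).
have Om0 : (0 < #|{ffun 'I_m -> Om}|)%N.
  rewrite card_ffun expn_gt0 card_prod muln_gt0 card_prod !card_ord muln_gt0 K0 r0 /=.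
  by rewrite card_ffun expn_gt0 card_prod !card_ord muln_gt0 D0 s0.
have -> : acceptance (sample_law R L h e sel false) (sample_law R L h e sel true) F =
    avg (fun w : {ffun 'I_m -> Om} => F [ffun i => e (x w i)]).
  rewrite -(sum_pushforward (fun (i : 'I_m) (u : Om) => e (cell L h sel (n <= i)%N (u.1, u.2 u.1)))).
  apply: eq_bigr => z _; congr (_ * _); apply: eq_bigr => i _.
  by rewrite [(n <= i)%N]leqNgt; case: ifP => _ /=; apply: sample_law_seeds.
rewrite order_acceptanceE -avgB; apply: le_trans (ler_norm_avg _) _.
pose v (u : Om) : 'I_s := (u.2 u.1).2.
apply: (@le_trans _ _ (avg (fun w : {ffun 'I_m -> Om} =>
    eta + \sum_i \sum_(j | i != j) (v (w i) == v (w j))%:R))).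
  apply: ler_avg => w; have S0 i : 0 <= \sum_(j | i != j) (v (w i) == v (w j))%:R :> R.
    by rewrite sumr_ge0.
  case: (boolP (injectiveb (fun i => v (w i)))) => [/injectiveP vI|].
    have xI : injective (x w).
      move=> i j /(congr1 val) /(congr1 (modn^~ s)) /=.
      rewrite !pos_mod => vij.
      by apply: vI; apply: val_inj.
    have -> : pat (fun i => pos L h sel (n <= i)%N ((w i).1, (w i).2 (w i).1) * m + i)%N =
              pat (fun i => x w i).
      apply/ffunP => -[i j]; rewrite !ffunE /= lt_lex //.
      have [->|nij] := eqVneq i j; first by rewrite !ltnn andbF.
      by case: eqP => [xij|_]; rewrite ?orbF //; case/eqP: nij; apply/xI/val_inj.
    by apply: (le_trans (FG _ xI)); rewrite lerDl sumr_ge0.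
  case/injectivePn => i [j ij vij].
  have /andP[f0 f1] := F01 [ffun i => e (x w i)].
  have /andP[g0 g1] := G01 (pat (fun i => pos L h sel (n <= i)%N ((w i).1, (w i).2 (w i).1) * m + i)%N).
  apply: (@le_trans _ _ 1); first by rewrite ler_norml; lra.
  rewrite (bigD1 i) //= (bigD1 j) //= vij eqxx -addrA -[leLHS]add0r lerD //.
  by rewrite lerDl addr_ge0 // ?sumr_ge0.
rewrite avgD avg_cst // lerD2l avg_sum.
under eq_bigr do rewrite avg_sum.
have s1 : (0 < #|'I_s|)%N by rewrite card_ord.
have vunif a : avg (fun u : Om => (v u == a)%:R) = #|'I_s|%:R^-1 :> R.
  rewrite avg_pair (@eq_avg _ _ _ (fun=> #|'I_s|%:R^-1)) => [|j].
    by rewrite avg_cst // card_prod !card_ord muln_gt0 K0.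
  rewrite /v /= (avg_coord j (fun t : seed D s => (t.2 == a)%:R)); last first.
    by rewrite card_prod !card_ord muln_gt0 D0.
  rewrite avg_pair (@eq_avg _ _ _ (fun=> #|'I_s|%:R^-1)) ?avg_cst ?card_ord // => d.
  rewrite /avg (bigD1 a) //= eqxx big1 ?addr0 ?mul1r ?card_ord // => b /negPf -> //.
have -> : m%:R ^+ 2 / s%:R = \sum_(i < m) \sum_(j < m) (s%:R^-1 : R).
  by rewrite !sumr_const !card_ord -mulrnA -[RHS]mulr_natl natrM.
apply: ler_sum => i _; rewrite [leRHS](bigID (fun j => i != j)) /=.
rewrite (eq_bigr (fun=> s%:R^-1)) => [|j ij]; first by rewrite lerDl sumr_ge0 // => j _; rewrite invr_ge0.
by rewrite (avg_agree ij s1 vunif) card_ord.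
Qed.

Definition selected (K r : nat) (rho : {ffun 'I_K -> 'I_r}) (j : blocks K r) : bool :=
  rho j.1 == j.2.

(** With [alpha = 1 / 5] the bound is [1 / 10 + 5 * (1 / 100) = 3 / 20]. The constant is
    [8192 = 2 * 4 * 1024], from [m = 2 n], the squared 2 of [law_chi2] and [avg_fiber_weight]. *)
Lemma order_acceptance_dist (R : realFieldType) (n K r L D h : nat)
    (G : pattern (n + n) -> R) :
    (0 < K)%N -> (0 < r)%N -> (0 < D)%N -> (n + n <= h.*2.+1)%N ->
    (1024 * (n + n) <= K * r)%N -> (forall o, 0 <= G o <= 1) ->
    8192 * n%:R * (L%:R / (D%:R ^+ 3 * r%:R)) ^+ 2 <= 1 / 100 :> R ->
  `|avg (fun rho : {ffun 'I_K -> 'I_r} => order_acceptance D h.*2.+1 L h G (selected rho))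
    - order_acceptance D h.*2.+1 L h G (fun _ : blocks K r => false)| <= 3 / 20.
Proof.
have al0 : 0 < 1 / 5 :> R by lra.
have al2 : 1 / 5 <= 1 / 2 :> R by lra.
move=> K0 r0 D0 ms Kr G01 small.
set m := (n + n)%N in G ms Kr G01 *; set s := h.*2.+1 in ms *.
pose S (beta : {ffun 'I_m -> blocks K r}) j := [set i | beta i == j].
pose a beta j o : R := law R n L h D s false (S beta j) o.
pose b beta j o : R := law R n L h D s true (S beta j) o.
pose chi beta := \sum_j \sum_o (b beta j o - a beta j o) ^+ 2 / a beta j o.
have J0 : (0 < #|blocks K r|)%N by rewrite card_prod !card_ord muln_gt0 K0.
have s0 : (0 < s)%N by [].
have r0' : 0 < r%:R :> R by rewrite ltr0n.
have D0' : 0 < D%:R :> R by rewrite ltr0n.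
apply: (@le_trans _ _ (avg (fun beta => 1 / 5 / 2 + chi beta / r%:R ^+ 2 / (1 / 5)))).
  (* The selection does not affect [beta], so [beta] can be fixed first and the averages over [rho]
     compared for each [beta]. *)
  rewrite /order_acceptance avg_exchange -avgB; apply: le_trans (ler_norm_avg _) _.
  apply: ler_avg => beta.
  pose H (o : {ffun blocks K r -> pattern m}) : R :=
    G [ffun ii => if beta ii.1 == beta ii.2 then o (beta ii.1) ii
                    else (block_index (beta ii.1) < block_index (beta ii.2))%N].
  have := @block_second_moment R 'I_K 'I_r (pattern m) (a beta) (b beta) H (1 / 5).
  rewrite !card_ord => bsm.
  rewrite (@eq_avg _ _ _ (fun rho : {ffun 'I_K -> 'I_r} => \sum_(o : {ffun blocks K r -> pattern m})
       (\prod_j (if rho j.1 == j.2 then b beta j (o j) else a beta j (o j))) * H o)); last first.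
    move=> rho; apply: eq_bigr => o _; congr (_ * _); apply: eq_bigr => j _.
    by rewrite /selected /a /b; case: (_ == _).
  apply: bsm => //.
  - by move=> j o; apply: law_ge0.
  - by move=> j o; apply: law_ge0.
  - by move=> j; apply: law1.
  - by move=> j; apply: law1.
  - by move=> j o; apply: law_abs_cont.
  - by move=> o; apply: G01.
have chi_le beta : chi beta <= \sum_j (((2 * #|S beta j|) ^ #|S beta j| * #|S beta j| ^ 6)%:R
     * (4 * (L%:R / D%:R ^+ 3) ^+ 2)).
  apply: ler_sum => j _; apply: le_trans (law_chi2 _ _ _ _ D0 ms) _.
  rewrite le_eqVlt; apply/orP; left; apply/eqP.
  by rewrite natrM [(#|_| ^ 6)%:R]natrX; ring.
have chi_avg : avg chi <= (K * r)%:R * (1024 * m%:R / (K * r)%:R * (4 * (L%:R / D%:R ^+ 3) ^+ 2)).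
  apply: le_trans (ler_avg chi_le) _; rewrite avg_sum.
  have -> : (K * r)%:R = #|blocks K r|%:R :> R by rewrite card_prod !card_ord.
  set c := 1024 * _ / _ * _; have -> : #|blocks K r|%:R * c = \sum_(j : blocks K r) c.
    by rewrite sumr_const mulr_natl.
  apply: ler_sum => j _.
  rewrite avgZr; apply: ler_wpM2r; first by apply: mulr_ge0; rewrite ?sqr_ge0.
  by apply: avg_fiber_weight; rewrite card_prod !card_ord.
have Kr0 : (K * r)%:R != 0 :> R by rewrite pnatr_eq0 -lt0n muln_gt0 K0.
have chi_avg2 : avg chi / r%:R ^+ 2 <= 1 / 100.
  apply: le_trans small; rewrite ler_pdivrMr ?exprn_gt0 //.
  apply: (le_trans chi_avg); rewrite le_eqVlt; apply/orP; left; apply/eqP.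
  by rewrite /m natrD; field; rewrite !gt_eqF ?ltr0n.
rewrite avgD avg_cst ?card_ffun ?expn_gt0 ?J0 // !avgZr; lra.
Qed.

Lemma indistinguishable (R : archiRealFieldType) (n K r L D : nat) :
    (0 < K)%N -> (0 < r)%N -> (0 < D)%N -> (1024 * (n + n) <= K * r)%N ->
    8192 * n%:R * (L%:R / (D%:R ^+ 3 * r%:R)) ^+ 2 <= 1 / 100 :> R ->
  exists N h, (0 < N)%N /\ forall F : {ffun 'I_(n + n) -> 'I_N} -> R,
    (forall z, 0 <= F z <= 1) ->
    exists e : 'I_(K * r * (D * 3 * h.*2.+1)) -> 'I_N,
      (forall a b : 'I_(K * r * (D * 3 * h.*2.+1)), (a < b)%N -> (e a < e b)%N) /\
      `|avg (fun rho : {ffun 'I_K -> 'I_r} =>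
           acceptance (sample_law R L h e (selected rho) false)
                      (sample_law R L h e (selected rho) true) F)
        - acceptance (sample_law R L h e (fun=> false) false)
                     (sample_law R L h e (fun=> false) true) F| <= 1 / 4.
Proof.
move=> K0 r0 D0 Kr small; pose m := (n + n)%N.
(* This makes the repetition term [m^2 / s] at most [1 / 100]; with the rounding, each passage to
   orders costs [1 / 50]. *)
pose h := (100 * m ^ 2)%N; pose s := h.*2.+1.
have [N [N0 hN]] := ramsey_order R m (K * r * (D * 3 * s)).
exists N, h; split=> // F F01; have [e [G [eI G01 FG]]] := hN F F01.
exists e; split=> //.
have err sel : `|acceptance (sample_law R L h e sel false) (sample_law R L h e sel true) F
    - order_acceptance D s L h G sel| <= 1 / 50.
  have eta0 : 0 <= 1 / 100 :> R by lra.
  have oi := @order_invariant_acceptance R N K r D s L h n F G e sel (1 / 100) K0 r0 D0 isT eta0 F01 G01 FG.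
  apply: (le_trans oi).
  have -> : 1 / 50 = 1 / 100 + 1 / 100 :> R by lra.
  rewrite lerD2l ler_pdivrMr ?ltr0n // mulrAC mul1r ler_pdivlMr // -natrX -natrM ler_nat.
  by rewrite mulnC -/h /s -addnn leqW // leq_addr.
have ms : (n + n <= h.*2.+1)%N by rewrite /h /m; nia.
have := order_acceptance_dist K0 r0 D0 ms Kr G01 small.
have Z0 : (0 < #|{ffun 'I_K -> 'I_r}|)%N by rewrite card_ffun !card_ord expn_gt0 r0.
have avg_err : `|avg (fun rho : {ffun 'I_K -> 'I_r} =>
           acceptance (sample_law R L h e (selected rho) false)
                      (sample_law R L h e (selected rho) true) F) -
    avg (fun rho : {ffun 'I_K -> 'I_r} => order_acceptance D s L h G (selected rho))| <= 1 / 50.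
  rewrite -avgB; apply: le_trans (ler_norm_avg _) _.
  rewrite -[leRHS](avg_cst _ Z0); apply: ler_avg => rho; exact: err.
move: avg_err (err (fun=> false)); rewrite -/s.
set A := avg _; set B := avg _; set C := acceptance _ _ _; set E := order_acceptance _ _ _ _ _ _.
(* [3 / 20 + 2 * (1 / 50) <= 1 / 4]. *)
rewrite !ler_norml; lra.
Qed.

(** * Distance of the two distributions *)

(** The level sets of the monotone [c] are an admissible partition, and a test function constant on
    each of them with values in [[-1, 1]] bounds the sum of the discrepancies from below. *)
Lemma Ak_dist_ge (R : realType) (N k : nat) (p q : {ffun 'I_N -> R})
    (c : 'I_N -> nat) (sgn : nat -> R) :
    (forall x y : 'I_N, (x <= y)%N -> (c x <= c y)%N) -> (forall x, (c x < k)%N) ->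
    (forall a, `|sgn a| <= 1) ->
  \sum_y sgn (c y) * (p y - q y) <= Ak_dist k p q.
Proof.
move=> c_mono ck sgn1.
pose P : {ffun 'I_k -> {set 'I_N}} := [ffun a : 'I_k => [set y | c y == a]].
have PP : interval_partition P.
  apply/and3P; split.
  - apply/forallP => a; apply/forallP => x; apply/implyP; rewrite ffunE inE => /eqP xa.
    apply/forallP => y; apply/implyP; rewrite inE => /eqP ya.
    apply/forallP => z; apply/implyP => /andP[xz zy]; rewrite inE eqn_leq.
    by rewrite -{1}ya -xa !c_mono.
  - apply/forallP => a; apply/forallP => b; apply/implyP => ab.
    rewrite -setI_eq0; apply/eqP/setP => y; rewrite !ffunE !inE.
    apply/negbTE; apply: contra ab => /andP[/eqP ca /eqP cb].
    by apply/eqP/val_inj; rewrite /= -ca -cb.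
  - apply/eqP/setP => y; rewrite inE; apply/bigcupP.
    by exists (Ordinal (ck y)) => //; rewrite ffunE inE.
apply: le_trans (le_bigmax_cond _ _ PP).
rewrite (partition_big (fun y => Ordinal (ck y)) xpredT) //=; apply: ler_sum => a _.
have -> : \sum_(y | Ordinal (ck y) == a) sgn (c y) * (p y - q y) =
    sgn a * (mass p (P a) - mass q (P a)).
  rewrite /mass -sumrB big_distrr /=; apply: eq_big => [y|y /eqP <- //].
  by rewrite ffunE inE.
apply: le_trans (ler_norm _) _; rewrite normrM.
by rewrite ler_piMl.
Qed.

Lemma sum_sample_law (R : realType) N K r D s L h e sel q (f : 'I_N -> R) :
  \sum_y f y * sample_law R L h e sel q y =
  avg (fun u : blocks K r * seed D s => f (e (cell L h sel q u))).
Proof.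
under eq_bigr do rewrite ffunE -avgZ.
rewrite -avg_sum; apply: eq_avg => u.
rewrite (bigD1 (e (cell L h sel q u))) //= eqxx mulr1 big1 ?addr0 // => y.
by rewrite eq_sym => /negPf ->; rewrite mulr0.
Qed.

Lemma sample_law_distr (R : realType) N K r D s L h e sel q :
  (0 < K)%N -> (0 < r)%N -> (0 < D)%N -> (0 < s)%N ->
  is_distr (@sample_law R N K r D s L h e sel q).
Proof.
move=> K0 r0 D0 s0; split; first by move=> y; rewrite ffunE; apply: avg_ge0.
under eq_bigr do rewrite -[sample_law _ _ _ _ _ _ _]mul1r.
rewrite (sum_sample_law _ _ _ _ _ (fun=> 1)) avg_cst //.
by rewrite !card_prod !card_ord !muln_gt0 K0 r0 D0.
Qed.

(* The [K * L] cells where only [q] avoids the middle third are cut out by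
   [2 * K * L] boundaries; the parity of the number of boundaries to the left of
   a point tells the middle thirds from the rest. *)
Lemma sample_law_far (R : realType) N K r D L h k
    (e : 'I_(K * r * (D * 3 * h.*2.+1)) -> 'I_N) (rho : {ffun 'I_K -> 'I_r}) :
    (0 < K)%N -> (0 < r)%N -> (0 < L)%N -> (L <= D)%N -> (2 * (K * L) < k)%N ->
    (forall a b : 'I_(K * r * (D * 3 * h.*2.+1)), (a < b)%N -> (e a < e b)%N) ->
  2 * L%:R / (r%:R * D%:R) <= Ak_dist k (sample_law R L h e (selected rho) false)
                                        (sample_law R L h e (selected rho) true).
Proof.
move=> K0 r0 L0 LD KLk e_lt; set s := h.*2.+1 in e e_lt *.
have D0 : (0 < D)%N by apply: leq_trans LD.
pose Z (j : blocks K r) (d : nat) := (block_index j * D + d)%N.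
pose bnd (kl : 'I_K * 'I_L) (a : nat) := ((Z (kl.1, rho kl.1) kl.2 * 3 + a) * s)%N.
(* The existential makes sense of being to the right of a boundary for points outside the image of
   [e]; on the image, [BE] reduces it to positions. *)
pose B kl a (y : 'I_N) : bool := [exists x, (val x == bnd kl a) && (e x <= y)%N].
pose c (y : 'I_N) := (\sum_kl (B kl 1 y + B kl 2 y))%N.
pose sgn a : R := if odd a then 1 else -1.
have e_le (a b : 'I_(K * r * (D * 3 * s))) : (a <= b)%N -> (e a <= e b)%N.
  by rewrite leq_eqVlt => /orP[/eqP/val_inj ->//|/e_lt/ltnW].
have BE kl a (x : 'I_(K * r * (D * 3 * s))) : B kl a (e x) = (bnd kl a <= x)%N.
  apply/existsP/idP => [[x' /andP[/eqP <- xx]]|bx].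
    by rewrite leqNgt; apply/negP => /e_lt; rewrite ltnNge xx.
  by exists (Ordinal (leq_ltn_trans bx (ltn_ord x))); rewrite eqxx e_le.
have oddE sel q u : odd (c (e (cell L h sel q u))) =
   \big[addb/false]_(kl : 'I_K * 'I_L)
     ((Z (kl.1, rho kl.1) kl.2 == Z u.1 u.2.1) && (inner L h (sel u.1) q u.2 == 1%N)).
  rewrite /c (big_morph odd oddD (erefl _)); apply: eq_bigr => kl _.
  rewrite !BE /=.
  have posE : pos L h sel q u = ((Z u.1 u.2.1 * 3 + inner L h (sel u.1) q u.2) * s + u.2.2)%N.
    by rewrite /pos /loc /Z; ring.
  have bndE a : (bnd kl a <= pos L h sel q u)%N =
      (Z (kl.1, rho kl.1) kl.2 * 3 + a <= Z u.1 u.2.1 * 3 + inner L h (sel u.1) q u.2)%N.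
    rewrite posE /bnd leqNgt -[X in (_ < X)%N]addn0 lt_lex // ltn0 andbF orbF.
    by rewrite -leqNgt.
  rewrite !bndE; have := inner_lt3 L h (sel u.1) q u.2.
  move: (inner _ _ _ _ _) (Z _ _) (Z _ _) => i z1 z2 i3.
  by rewrite oddD !oddb; case: eqP; case: eqP; case: leqP; case: leqP => //=; lia.
have ZI (j j' : blocks K r) d d' : (d < D)%N -> (d' < D)%N -> Z j d = Z j' d' -> j = j' /\ d = d'.
  move=> dD d'D E.
  have E1 := congr1 (divn^~ D) E; have E2 := congr1 (modn^~ D) E.
  rewrite /= /Z !divnMDl // !divn_small // !addn0 in E1.
  rewrite /= /Z !modnMDl !modn_small // in E2.
  by split=> //; apply: block_index_inj.
pose act (u : blocks K r * seed D s) := selected rho u.1 && (u.2.1 < L)%N.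
have same u : ~~ act u -> cell L h (selected rho) true u = cell L h (selected rho) false u.
  rewrite /act => nact; apply: val_inj; rewrite /= /pos /loc /inner /= andbF /=.
  by rewrite (negPf nact).
have odd_p u : act u -> odd (c (e (cell L h (selected rho) false u))).
  case/andP => /eqP us uL; rewrite oddE (bigD1 (u.1.1, Ordinal uL)) //= big1 ?addbF.
    by rewrite /inner /= !andbF eqxx us -surjective_pairing eqxx.
  move=> [k' l] /= ne; apply/negbTE; apply: contra ne => /andP[/eqP E _].
  have [|//|E1 E2] := ZI _ _ _ _ _ _ E; first by apply: leq_trans LD.
  by apply/eqP; rewrite -E1 /=; congr (_, _); apply: val_inj.
have odd_q u : act u -> ~~ odd (c (e (cell L h (selected rho) true u))).
  case/andP => us uL; rewrite oddE big1 // => kl _.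
  by rewrite /inner us uL /=; case: ifP; rewrite andbF.
apply: le_trans (@Ak_dist_ge _ _ _ _ _ c sgn _ _ _).
- under eq_bigr do rewrite mulrBr.
  rewrite sumrB !sum_sample_law -avgB.
  (* With the same seed, an active sample has sign 1 under [p] and -1 under [q], and any other
     sample does not move. A seed is active with probability [L / (r D)]. *)
  apply: (@le_trans _ _ (avg (fun u => 2 * (act u)%:R))); last first.
    apply: ler_avg => u; case: (boolP (act u)) => [au|/same ->]; last by rewrite mulr0 subrr.
    by rewrite /sgn (odd_p u au) (negPf (odd_q u au)) mulr1 opprK.
  rewrite avgZ -mulrA ler_wpM2l //.
  rewrite (@eq_avg _ _ _ (fun u : blocks K r * seed D s =>
     (selected rho u.1)%:R * (u.2.1 < L)%:R)); last by move=> u; rewrite -natrM mulnb.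
  rewrite avg_pair (@eq_avg _ _ _ (fun j => (selected rho j)%:R *
    avg (fun t : seed D s => (t.1 < L)%:R))) => [|j]; last by rewrite -avgZ.
  rewrite avgZr.
  have -> : avg (fun j => (selected rho j)%:R) = r%:R^-1 :> R.
    rewrite avg_pair (@eq_avg _ _ _ (fun=> r%:R^-1)) ?avg_cst ?card_ord // => k'.
    rewrite /avg /selected (bigD1 (rho k')) //= eqxx big1 ?addr0 ?mul1r ?card_ord // => i.
    by rewrite eq_sym => /negPf ->.
  have -> : avg (fun t : seed D s => (t.1 < L)%:R) = L%:R / D%:R :> R.
    rewrite avg_pair (@eq_avg _ _ _ (fun d : 'I_D => (d < L)%:R)) => [|d].
      rewrite /avg card_ord -natr_sum; congr (_%:R / _).
      rewrite -(big_mkord xpredT (fun d => (d < L)%N : nat)).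
      have -> j : (\sum_(0 <= d < j) (d < L) = minn j L)%N.
        elim: j => [|j IH]; first by rewrite big_geq ?min0n.
        by rewrite big_nat_recr //= IH; lia.
      exact/minn_idPr.
    by rewrite /= avg_cst ?card_ord.
  by rewrite invfM mulrCA.
- move=> x y xy; apply: leq_sum => kl _.
  have BB a : (B kl a x <= B kl a y)%N.
    rewrite /B; case: existsP => // -[z /andP[zb zx]].
    by rewrite lt0b; apply/existsP; exists z; rewrite zb (leq_trans zx).
  exact: leq_add.
(* [2 * K * L] boundaries leave [2 * K * L + 1] intervals, whence the strict inequality with [k]. *)
- move=> x; apply: leq_ltn_trans KLk; rewrite mulnC.
  apply: (@leq_trans (\sum_(kl : 'I_K * 'I_L) 2)); last by rewrite sum_nat_const card_prod !card_ord.
  by apply: leq_sum => kl _; rewrite (@leq_add _ _ 1 1) ?leq_b1.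
- by move=> a; rewrite /sgn; case: odd; rewrite ?normrN normr1.
Qed.

(** * Uniformity testing *)

Lemma answer_prob_compl (R : realType) N (p q : {ffun 'I_N -> R}) (A : algorithm R N) :
  is_distr p -> is_distr q -> answer_prob p q A true + answer_prob p q A false = 1.
Proof.
move=> [_ p1] [_ q1]; elim: A => [[]|r A1 IH1 A2 IH2|next IH|next IH] /=.
- by rewrite addr0.
- by rewrite add0r.
- set a := answer_prob p q A1 true in IH1 *; set b := answer_prob p q A2 true in IH2 *.
  by rewrite -[answer_prob p q A1 false](addKr a) -[answer_prob p q A2 false](addKr b) IH1 IH2; ring.
- by rewrite -big_split -[RHS]p1; apply: eq_bigr => i _ /=; rewrite -mulrDr IH mulr1.
- by rewrite -big_split -[RHS]q1; apply: eq_bigr => i _ /=; rewrite -mulrDr IH mulr1.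
Qed.

(** Testing against a mixture: the error bounds hold for each alternative, hence for their average
    over [z]. [F] comes before the instance because the embedding is built from it. *)
Lemma tester_gap (R : realType) (N k n : nat) (eps : R) (A : algorithm R N) :
    Ak_closeness_tester k eps A -> (nsamples A <= n)%N ->
  exists F : {ffun 'I_(n + n) -> 'I_N} -> R, (forall z, 0 <= F z <= 1) /\
    forall (Z : finType) (p q : Z -> {ffun 'I_N -> R}) (u : {ffun 'I_N -> R}),
      (0 < #|Z|)%N -> is_distr u ->
      (forall z, [/\ is_distr (p z), is_distr (q z) & eps <= Ak_dist k (p z) (q z)]) ->
      1 / 3 <= `|avg (fun z => acceptance (p z) (q z) F) - acceptance u u F|.
Proof.
move=> tA An; have [F [F01 FE]] := nonadaptive true An.
exists F; split=> // Z p q u Z0 du dpq.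
have hu : 2 / 3 <= acceptance u u F.
  by rewrite /acceptance -FE //; have [h _] := tA u u du du; apply: h.
have hz : avg (fun z => acceptance (p z) (q z) F) <= 1 / 3.
  rewrite -[leRHS](avg_cst _ Z0); apply: ler_avg => z; have [dp dq far] := dpq z.
  rewrite /acceptance -FE //; have [_ /(_ far)] := tA _ _ dp dq.
  by have := answer_prob_compl A dp dq; lra.
rewrite distrC; apply: le_trans (ler_norm _); lra.
Qed.

(** The bounds [1 / (1 - x)] and [1 / (1 + x)] on the two exponentials average to
    [1 / (1 - x^2)]. *)
Lemma cosh_le (R : realType) (x : R) : 0 <= x -> x <= 1 / 2 ->
  (expR x + expR (- x)) / 2 <= 1 + 2 * x ^+ 2.
Proof.
move=> x0 x2.
have e1 : expR x <= (1 - x)^-1.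
  rewrite -[expR x]invrK -expRN lef_pV2 ?posrE ?expR_gt0; [|lra..].
  by have := expR_ge1Dx (- x).
have e2 : expR (- x) <= (1 + x)^-1.
  by rewrite expRN lef_pV2 ?posrE ?expR_gt0; [exact: expR_ge1Dx|lra..].
have e3 : (1 - x)^-1 + (1 + x)^-1 = 2 * (1 - x ^+ 2)^-1.
  by field; apply/and3P; split; rewrite gt_eqF //; nra.
have x22 : x ^+ 2 <= 1 / 2 by nra.
have e4 : (1 - x ^+ 2)^-1 <= 1 + 2 * x ^+ 2.
  rewrite -[leLHS]mul1r ler_pdivrMr; last by lra.
  by move: (x ^+ 2) (sqr_ge0 x) x22 => y; nra.
lra.
Qed.

Definition tilt (R : realType) (h : nat) (z : {ffun 'I_h -> bool}) (y : 'I_(h + h)) : R :=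
  match fintype.split y with inl a => (-1) ^+ z a | inr a => - (-1) ^+ z a end.

Lemma sum_tilt (R : realType) h (z : {ffun 'I_h -> bool}) : \sum_y tilt R z y = 0.
Proof.
rewrite big_split_ord /= -big_split big1 // => a _ /=.
by rewrite /tilt (unsplitK (inl a)) (unsplitK (inr a)) subrr.
Qed.

Lemma sum_tilt2 (R : realType) h (z z' : {ffun 'I_h -> bool}) :
  \sum_y tilt R z y * tilt R z' y = 2 * \sum_a (-1) ^+ (z a (+) z' a).
Proof.
rewrite big_split_ord /= -big_split big_distrr; apply: eq_bigr => a _ /=.
rewrite /tilt (unsplitK (inl a)) (unsplitK (inr a)) mulrNN signr_addb; ring.
Qed.

Definition tilted (R : realType) (h : nat) (eps : R) (z : {ffun 'I_h -> bool}) :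
    {ffun 'I_(h + h) -> R} :=
  [ffun y => (1 + eps * tilt R z y) / (h + h)%:R].

Lemma tilt_sqr (R : realType) h (z : {ffun 'I_h -> bool}) y : tilt R z y ^+ 2 = 1.
Proof. by rewrite /tilt; case: fintype.split => a; rewrite ?sqrrN sqrr_sign. Qed.

Lemma tilt_norm (R : realType) h (z : {ffun 'I_h -> bool}) y : `|tilt R z y| = 1.
Proof. by rewrite /tilt; case: fintype.split => a; rewrite ?normrN normr_sign. Qed.

Lemma tilted_distr (R : realType) h (eps : R) (z : {ffun 'I_h -> bool}) :
  (0 < h)%N -> 0 <= eps <= 1 -> is_distr (tilted eps z).
Proof.
move=> h0 /andP[e0 e1]; split=> [y|].
  rewrite ffunE divr_ge0 //; have := tilt_norm R z y; move/eqP; rewrite eqr_norml //.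
  by case/andP => /orP[] /eqP -> _; lra.
under eq_bigr do rewrite ffunE mulrDl mul1r.
rewrite big_split /= sumr_const card_ord -mulr_suml -mulr_sumr sum_tilt mulr0 mul0r addr0.
by rewrite -[_ *+ _]mulr_natl divff // pnatr_eq0 -lt0n addn_gt0 h0.
Qed.

(** Since [k >= 2 h], every point can be an interval of its own, and the distance is at least the
    full [L^1] distance [eps]. *)
Lemma tilted_far (R : realType) h k (eps : R) (z : {ffun 'I_h -> bool}) :
  (0 < h)%N -> (h + h <= k)%N -> eps <= Ak_dist k (tilted 0 z) (tilted eps z).
Proof.
move=> h0 hk.
pose sgn (a : nat) : R := if insub a is Some y then - tilt R z y else 0.
apply: le_trans (@Ak_dist_ge _ _ _ _ _ (fun y : 'I_(h + h) => y : nat) sgn _ _ _).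
- rewrite (eq_bigr (fun=> eps / (h + h)%:R)) => [|y _].
    by rewrite sumr_const card_ord -[_ *+ _]mulr_natl mulrC divfK // pnatr_eq0 -lt0n addn_gt0 h0.
  rewrite /sgn valK !ffunE mul0r addr0 -mulrBl opprD addrA subrr add0r mulrA mulrNN.
  by rewrite mulrCA -expr2 tilt_sqr mulr1.
- by [].
- by move=> y; apply: leq_trans hk.
- by move=> a; rewrite /sgn; case: insub => [y|]; rewrite ?normrN ?tilt_norm ?normr0.
Qed.

Lemma uniformity_lower_bound (R : realType) (h k n : nat) (eps : R) (A : algorithm R (h + h)) :
    (0 < h)%N -> (h + h <= k)%N -> 0 < eps -> eps <= 1 ->
    n%:R ^+ 2 * eps ^+ 4 / h%:R <= 1 / 100 -> (nsamples A <= n)%N ->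
  ~ Ak_closeness_tester k eps A.
Proof.
move=> h0 hk e0 e1 small An tA.
have [F [F01 gap]] := tester_gap tA An.
have hR : 0 < h%:R :> R by rewrite ltr0n.
set N := (h + h)%N in A An tA F F01 gap *; set m := (n + n)%N in F F01 gap *.
have N0 : 0 < N%:R :> R by rewrite ltr0n addn_gt0 h0.
pose z0 : {ffun 'I_h -> bool} := [ffun=> false].
pose u : {ffun 'I_N -> R} := tilted 0 z0.
have uE y : u y = N%:R^-1 by rewrite ffunE mul0r addr0 mul1r.
have du : is_distr u by apply: tilted_distr; rewrite ?lexx ?ler01.
have Z0 : (0 < #|{ffun 'I_h -> bool}|)%N by rewrite card_ffun expn_gt0 card_bool.
have far z : [/\ is_distr u, is_distr (tilted eps z) & eps <= Ak_dist k u (tilted eps z)].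
  split=> //; first by apply: tilted_distr => //; rewrite (ltW e0).
  have -> : u = tilted 0 z by apply/ffunP => y; rewrite uE ffunE mul0r addr0 mul1r.
  exact: tilted_far.
have {gap} := gap _ (fun=> u) (fun z => tilted eps z) u Z0 du far.
apply/negP; rewrite -ltNge.
pose a (w : {ffun 'I_m -> 'I_N}) : R := \prod_i u (w i).
pose g (z : {ffun 'I_h -> bool}) (i : 'I_m) (y : 'I_N) : R :=
  if (i < n)%N then 1 else 1 + eps * tilt R z y.
pose f z (w : {ffun 'I_m -> 'I_N}) := \prod_i g z i (w i).
have a0 w : 0 <= a w by apply: prodr_ge0 => i _; rewrite uE invr_ge0 ltW.
have usum : \sum_y u y = 1 by case: du.
have a1 : \sum_w a w = 1 by rewrite (sum_ffun_prod (fun _ => u)) big1.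
have gsum z i : \sum_y u y * g z i y = 1.
  rewrite /g; case: (i < n)%N; first by under eq_bigr do rewrite mulr1.
  transitivity (\sum_y (u y + N%:R^-1 * eps * tilt R z y)).
    by apply: eq_bigr => y _; rewrite uE; ring.
  by rewrite big_split /= -mulr_sumr sum_tilt usum mulr0 addr0.
have f1 z : \sum_w a w * f z w = 1.
  transitivity (\prod_(i < m) \sum_y u y * g z i y); last by rewrite big1.
  by rewrite -sum_ffun_prod; apply: eq_bigr => w _; rewrite -big_split.
have al0 : 0 < 1 / 5 :> R by lra.
have := second_moment al0 Z0 a0 a1 F01 f1.
have -> : avg (fun z => \sum_o a o * f z o * F o) = avg (fun z => acceptance u (tilted eps z) F).
  apply: eq_avg => z; apply: eq_bigr => w _; congr (_ * _).
  rewrite /a /f -big_split; apply: eq_bigr => i _ /=; rewrite /g.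
  by case: ifP => _; rewrite ?mulr1 // [tilted eps z _]ffunE uE mulrC.
have -> : \sum_o a o * F o = acceptance u u F.
  by apply: eq_bigr => w _; congr (_ * _); apply: eq_bigr => i _; case: ifP.
move=> /le_lt_trans; apply.
(* [h * x^2] is exactly the quantity bounded by [1 / 100] in the hypothesis. *)
pose x : R := n%:R * (eps ^+ 2 / h%:R).
have x0 : 0 <= x by rewrite mulr_ge0 // divr_ge0 ?sqr_ge0 // ltW.
have hx : h%:R * x ^+ 2 <= 1 / 100.
  by apply: le_trans small; rewrite le_eqVlt; apply/orP; left; apply/eqP; rewrite /x; field; rewrite gt_eqF.
have hh : h%:R * (2 * x ^+ 2) <= 1 / 2 by move: hx; clear; move: (x ^+ 2) => y; lra.
have x2 : x <= 1 / 2.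
  have h1 : 1 <= h%:R :> R by rewrite ler1n.
  rewrite leNgt; apply/negP => xx; nra.
(* Then [second_moment] with [alpha = 1 / 5] yields [1 / 10 + 1 / 10], below the gap [1 / 3]. *)
suff : avg (fun z => avg (fun z' => \sum_o a o * (f z o * f z' o))) <= 1 + 4 * (1 / 100).
  by move: (avg _) => V; lra.
apply: (@le_trans _ _ (\prod_(i < h) ((expR x + expR (- x)) / 2))); last first.
  apply: (@le_trans _ _ (\prod_(i < h) (1 + 2 * x ^+ 2))).
    apply: ler_prod => i _; rewrite cosh_le // andbT divr_ge0 // addr_ge0 ?expR_ge0 //.
  have := @prod_1D_le R 'I_h (fun=> 2 * x ^+ 2).
  rewrite sumr_const card_ord -[_ *+ h]mulr_natl.
  have pos : forall i : 'I_h, 0 <= 2 * x ^+ 2 by move=> _; rewrite mulr_ge0 ?sqr_ge0.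
  move=> /(_ pos hh); rewrite lerBlDr => /le_trans; apply.
  by move: hx; clear; move: (x ^+ 2) => y; lra.
have term (z z' : {ffun 'I_h -> bool}) : \sum_o a o * (f z o * f z' o) <=
    \prod_i expR (x * (-1) ^+ (z i (+) z' i)).
  (* [C] is the mean of the [h] products of signs; the likelihood ratios of one sample of [q] have
     correlation [1 + eps^2 * C]. *)
  pose C : R := (\sum_i (-1) ^+ (z i (+) z' i)) / h%:R.
  have gg i : \sum_y u y * (g z i y * g z' i y) = if (i < n)%N then 1 else 1 + eps ^+ 2 * C.
    rewrite /g; case: (i < n)%N; first by under eq_bigr do rewrite !mulr1.
    transitivity (\sum_y (u y + N%:R^-1 * eps * tilt R z y + N%:R^-1 * eps * tilt R z' y
        + N%:R^-1 * eps ^+ 2 * (tilt R z y * tilt R z' y))).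
      by apply: eq_bigr => y _; rewrite uE; ring.
    rewrite !big_split /= -!mulr_sumr !sum_tilt sum_tilt2 usum !mulr0 !addr0 /C /N natrD.
    by field; rewrite !gt_eqF ?addr_gt0.
  have -> : \sum_o a o * (f z o * f z' o) = (1 + eps ^+ 2 * C) ^+ n.
    transitivity (\prod_(i < m) (if (i < n)%N then 1 else 1 + eps ^+ 2 * C)).
      under [RHS]eq_bigr do rewrite -gg.
      rewrite -sum_ffun_prod; apply: eq_bigr => w _.
      by rewrite -!big_split.
    rewrite big_split_ord /= big1 ?mul1r => [|i _]; last by rewrite ltn_ord.
    rewrite (eq_bigr (fun=> 1 + eps ^+ 2 * C)) => [|i _]; last by rewrite ltnNge leq_addr.
    by rewrite prodr_const card_ord.
  have C1 : `|C| <= 1.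
    rewrite normrM [`|_^-1|]gtr0_norm ?invr_gt0 // ler_pdivrMr // mul1r.
    apply: le_trans (ler_norm_sum _ _ _) _.
    under eq_bigr do rewrite normr_sign.
    by rewrite sumr_const card_ord.
  rewrite -expR_sum -mulr_sumr.
  have -> : x * (\sum_i (-1) ^+ (z i (+) z' i)) = n%:R * (eps ^+ 2 * C) by rewrite /x /C; ring.
  rewrite [n%:R * _]mulrC expRM_natr.
  (* From [1 + y <= expR y]; raising it to the power [n] requires [1 + eps^2 * C >= 0], which
     [eps <= 1] and [|C| <= 1] ensure. *)
  apply: lerXn2r; rewrite ?nnegrE ?expR_ge0 ?expR_ge1Dx //.
  have y0 : 0 <= eps ^+ 2 by rewrite sqr_ge0.
  have y1 : eps ^+ 2 <= 1 by rewrite expr_le1 // ltW.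
  move: C1 y0 y1; rewrite ler_norml => /andP[+ _]; clear.
  move: C (eps ^+ 2) => c y c1 y0 y1.
  have yc : 0 <= y * (c + 1) by rewrite mulr_ge0 //; lra.
  by lra.
apply: (@le_trans _ _ (avg (fun z : {ffun 'I_h -> bool} => avg (fun z' : {ffun 'I_h -> bool} =>
    \prod_i expR (x * (-1) ^+ (z i (+) z' i)))))).
  by apply: ler_avg => z; apply: ler_avg => z'; apply: term.
rewrite -[leRHS](avg_cst _ Z0); apply: ler_avg => z.
rewrite (avg_ffun_prod (fun i b => expR (x * (-1) ^+ (z i (+) b)))).
rewrite le_eqVlt; apply/orP; left; apply/eqP; apply: eq_bigr => i _.
rewrite /avg card_bool (bigD1 true) //= (bigD1 false) //= big1 ?addr0 => [|[]//].
by case: (z i); rewrite /= ?expr0 ?expr1 ?mulr1 ?mulrN1 // addrC.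
Qed.

(** * The lower bound *)

Lemma truncn_half (R : archiRealFieldType) (y : R) : 1 <= y ->
  [/\ (0 < Num.truncn y)%N, (Num.truncn y)%:R <= y & y / 2 <= (Num.truncn y)%:R].
Proof.
move=> y1; have y0 : 0 <= y by lra.
have /andP[lo hi] := @truncn_itv R _ y0.
have t0 : (0 < Num.truncn y)%N by rewrite truncn_gt0.
split=> //; move: hi t0; rewrite -(natr1 (Num.truncn _)) -(ler1n R).
by clear; move: (Num.truncn _)%:R => t; lra.
Qed.

Lemma half_pred_bounds k : (2 < k)%N ->
  [/\ (0 < k.-1./2)%N, (k <= 4 * k.-1./2)%N & (2 * k.-1./2 < k)%N].
Proof. by move=> k2; split; lia. Qed.

(** With [m = 2 C n] blocks wanted and [kap] modified cells allowed: if [m <= kap], every block is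
    selected ([r = 1]) with [L = kap / m] cells; otherwise one cell ([L = 1]) in one of about
    [m / kap] blocks. [D] is the largest integer that keeps the distance at least [eps]. *)
Lemma many_samples_params (R : archiRealFieldType) (C n k : nat) (c eps : R) :
    (0 < C)%N -> 0 < c -> (16 * C)%:R * c <= 2 -> (2 < k)%N -> 0 < eps -> eps <= 2 -> 1 <= k%:R * eps ->
    n%:R ^+ 5 * eps ^+ 6 <= c ^+ 5 * k%:R ^+ 4 ->
  exists K r L D : nat,
    [/\ [/\ (0 < K)%N, (0 < r)%N, (0 < L)%N & (L <= D)%N],
        (2 * (K * L) < k)%N, (C * (n + n) <= K * r)%N,
        n%:R * (L%:R / (D%:R ^+ 3 * r%:R)) ^+ 2 <= c ^+ 5 * (16 * C)%:R ^+ 4 :> R &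
        eps <= 2 * L%:R / (r%:R * D%:R)].
Proof.
move=> C0 c0; set E := (16 * C)%N => Ec k2 e0 e2 ke nk.
have ER : 0 <= E%:R :> R by rewrite ler0n.
have cge0 := ltW c0.
have [n0|n0] := posnP n.
  (* Without samples a single modified cell will do: its distance 2 covers every admissible
     [eps]. *)
  exists 1%N, 1%N, 1%N, 1%N; split=> //.
  - by rewrite n0 muln0.
  - by rewrite n0 mul0r; apply: mulr_ge0; apply: exprn_ge0.
  - by rewrite !mulr1 divr1.
have nR : 0 < n%:R :> R by rewrite ltr0n.
have kR : 0 < k%:R :> R by rewrite ltr0n (leq_trans _ k2).
have [] := half_pred_bounds k2; set kap := k.-1./2 => kap0 kap4 kap2.
pose m := (C * (n + n))%N.
have m0 : (0 < m)%N by rewrite muln_gt0 C0 addn_gt0 n0.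
have mE : (8 * m = E * n)%N by rewrite /m /E; ring.
have [nkap|kapn] := leqP m kap.
  pose L := (kap %/ m)%N.
  have L0 : (0 < L)%N by rewrite divn_gt0.
  have LR : 0 < L%:R :> R by rewrite ltr0n.
  have KL : (m * L <= kap)%N by rewrite mulnC leq_trunc_div.
  have kL : (k <= E * n * L)%N.
    apply: (leq_trans kap4); have := ltn_ceil kap m0; rewrite -/L -mE.
    rewrite mulSn => kL; have mL : (m <= L * m)%N by rewrite leq_pmull.
    have -> : (8 * m * L = 4 * (2 * (L * m)))%N by ring.
    by rewrite leq_mul2l /= (leq_trans (ltnW kL)) // mul2n -addnn leq_add2r.
  have y1 : 1 <= 2 * L%:R / eps.
    by rewrite ler_pdivlMr // mul1r; apply: le_trans e2 _; rewrite ler_peMr // ler1n.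
  have [D0 D1 D2] := truncn_half y1; set D := Num.truncn _ in D0 D1 D2.
  have DR : 0 < D%:R :> R by rewrite ltr0n.
  have eL : L%:R <= eps * D%:R.
    have -> : L%:R = eps * (2 * L%:R / eps / 2) by field; rewrite gt_eqF.
    by rewrite ler_wpM2l // ltW.
  exists m, 1%N, L, D; split.
  - split=> //; rewrite /D truncn_ge_nat; last by apply: le_trans y1.
    by rewrite ler_pdivlMr // [leRHS]mulrC ler_wpM2l // ltW.
  - by rewrite (leq_ltn_trans _ kap2) // leq_mul2l.
  - by rewrite muln1.
  - rewrite mulr1.
    have h1 : (L%:R / D%:R ^+ 3) ^+ 2 <= eps ^+ 6 / L%:R ^+ 4.
      rewrite ler_pdivlMr ?exprn_gt0 // expr_div_n mulrAC ler_pdivrMr ?exprn_gt0 ?exprn_gt0 //.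
      have -> : L%:R ^+ 2 * L%:R ^+ 4 = L%:R ^+ 6 :> R by ring.
      have -> : eps ^+ 6 * (D%:R ^+ 3) ^+ 2 = (eps * D%:R) ^+ 6 by ring.
      by apply: lerXn2r; rewrite ?nnegrE // ?mulr_ge0 // ltW.
    apply: (le_trans (ler_wpM2l (ltW nR) h1)).
    rewrite mulrA ler_pdivrMr ?exprn_gt0 // -(ler_pM2l (exprn_gt0 4 nR)).
    have -> : n%:R ^+ 4 * (n%:R * eps ^+ 6) = n%:R ^+ 5 * eps ^+ 6 by ring.
    apply: (le_trans nk).
    have h2 : k%:R ^+ 4 <= (E%:R * n%:R * L%:R) ^+ 4 :> R.
      apply: lerXn2r; rewrite ?nnegrE ?mulr_ge0 //.
      by rewrite -!natrM ler_nat.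
    apply: le_trans (ler_wpM2l _ h2) _; first by rewrite exprn_ge0.
    by rewrite le_eqVlt; apply/orP; left; apply/eqP; field.
  - by rewrite mul1r ler_pdivlMr // mulrC -ler_pdivlMr.
pose r := (m %/ kap).+1.
have rk : (r * k <= E * n)%N.
  have h1 : (m %/ kap * kap <= m)%N by rewrite leq_trunc_div.
  have h2 : (0 < m %/ kap)%N by rewrite divn_gt0 // ltnW.
  rewrite /r -mE; apply: (@leq_trans (2 * (m %/ kap) * (4 * kap))).
    by apply: leq_mul => //; rewrite mul2n -addnn -addn1 leq_add2l.
  have -> : (2 * (m %/ kap) * (4 * kap) = 8 * (m %/ kap * kap))%N by ring.
  by rewrite leq_mul2l h1 orbT.
have rR : 0 < r%:R :> R by rewrite ltr0n.
have rkR : r%:R * k%:R <= E%:R * n%:R :> R by rewrite -!natrM ler_nat.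
(* Here [1 <= k * eps] enters: [(n eps)^5 eps <= c^5 k^4 <= (c k)^5 eps]. The consequence
   [r * eps <= 2] makes [D] positive. *)
have nek : n%:R * eps <= c * k%:R.
  rewrite leNgt; apply/negP => h.
  have h5 : (c * k%:R) ^+ 5 < (n%:R * eps) ^+ 5.
    by rewrite ltr_pXn2r // ?nnegrE ?mulr_ge0 // ltW.
  have : (n%:R * eps) ^+ 5 * eps <= (c * k%:R) ^+ 5 * eps.
    have -> : (n%:R * eps) ^+ 5 * eps = n%:R ^+ 5 * eps ^+ 6 by ring.
    apply: (le_trans nk).
    have -> : (c * k%:R) ^+ 5 * eps = c ^+ 5 * k%:R ^+ 4 * (k%:R * eps) :> R by ring.
    by rewrite ler_peMr // mulr_ge0 ?exprn_ge0.
  by rewrite ler_pM2r // leNgt h5.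
have re : r%:R * eps <= 2.
  rewrite -(ler_pM2r kR).
  have -> : r%:R * eps * k%:R = r%:R * k%:R * eps by ring.
  apply: (le_trans (ler_wpM2r (ltW e0) rkR)); rewrite -mulrA.
  apply: (le_trans (ler_wpM2l ER nek)).
  by rewrite mulrA ler_wpM2r // ltW.
have re0 : 0 < r%:R * eps by rewrite mulr_gt0.
have y1 : 1 <= 2 / (r%:R * eps) by rewrite ler_pdivlMr //; lra.
have [D0 D1 D2] := truncn_half y1; set D := Num.truncn _ in D0 D1 D2.
have DR : 0 < D%:R :> R by rewrite ltr0n.
exists kap, r, 1%N, D; split=> //.
- by rewrite muln1.
- by have := ltn_ceil m kap0; rewrite -/r mulnC => /ltnW.
- have h0 : D%:R^-1 <= r%:R * eps.
    rewrite -[leRHS]invrK lef_pV2 ?posrE ?invr_gt0 //.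
    by apply: le_trans D2; rewrite mulrAC divff ?mul1r // pnatr_eq0.
  have h1 : (1 / (D%:R ^+ 3 * r%:R)) ^+ 2 <= r%:R ^+ 4 * eps ^+ 6.
    have -> : (1 / (D%:R ^+ 3 * r%:R)) ^+ 2 = (D%:R^-1) ^+ 6 / r%:R ^+ 2 :> R.
      by field; rewrite !gt_eqF.
    rewrite ler_pdivrMr ?exprn_gt0 //.
    have -> : r%:R ^+ 4 * eps ^+ 6 * r%:R ^+ 2 = (r%:R * eps) ^+ 6 by ring.
    by apply: lerXn2r; rewrite ?nnegrE ?invr_ge0 // ltW.
  apply: (le_trans (ler_wpM2l (ltW nR) h1)).
  rewrite -(ler_pM2r (exprn_gt0 4 kR)).
  have -> : n%:R * (r%:R ^+ 4 * eps ^+ 6) * k%:R ^+ 4 =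
            n%:R * eps ^+ 6 * (r%:R * k%:R) ^+ 4 by ring.
  have h2 : (r%:R * k%:R) ^+ 4 <= (E%:R * n%:R) ^+ 4 :> R.
    by apply: lerXn2r; rewrite ?nnegrE ?mulr_ge0.
  apply: (le_trans (ler_wpM2l _ h2)); first by rewrite mulr_ge0 ?exprn_ge0 // ltW.
  have -> : n%:R * eps ^+ 6 * (E%:R * n%:R) ^+ 4 = E%:R ^+ 4 * (n%:R ^+ 5 * eps ^+ 6) by ring.
  apply: (le_trans (ler_wpM2l _ nk)); first by rewrite exprn_ge0.
  by rewrite le_eqVlt; apply/orP; left; apply/eqP; field.
- rewrite mulr1 ler_pdivlMr ?mulr_gt0 //; move: D1; rewrite ler_pdivlMr //.
  by have -> : eps * (r%:R * D%:R) = D%:R * (r%:R * eps) by ring.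
Qed.

Lemma order_lower_bound (R : realType) (n K r L D k : nat) (eps : R) :
    (0 < K)%N -> (0 < r)%N -> (0 < L)%N -> (L <= D)%N -> (2 * (K * L) < k)%N ->
    (1024 * (n + n) <= K * r)%N ->
    8192 * n%:R * (L%:R / (D%:R ^+ 3 * r%:R)) ^+ 2 <= 1 / 100 :> R ->
    eps <= 2 * L%:R / (r%:R * D%:R) ->
  exists N, (0 < N)%N /\ forall A : algorithm R N, (nsamples A <= n)%N ->
    ~ Ak_closeness_tester k eps A.
Proof.
move=> K0 r0 L0 LD KL Kr small eps_le.
have D0 : (0 < D)%N by apply: leq_trans LD.
have [N [h [N0 ind]]] := indistinguishable K0 r0 D0 Kr small.
exists N; split=> // A An tA; have [F [F01 gap]] := tester_gap tA An.
have [e [e_lt close]] := ind F F01.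
have Z0 : (0 < #|{ffun 'I_K -> 'I_r}|)%N by rewrite card_ffun !card_ord expn_gt0 r0.
have distr sel q : is_distr (sample_law R L h e sel q) by apply: sample_law_distr.
have same : sample_law R L h e (fun=> false) false = sample_law R L h e (fun=> false) true.
  apply/ffunP => y; rewrite !ffunE; apply: eq_avg => u; congr (_ == _)%:R.
  by congr e; apply: val_inj.
have far rho : [/\ is_distr (sample_law R L h e (selected rho) false),
    is_distr (sample_law R L h e (selected rho) true) &
    eps <= Ak_dist k (sample_law R L h e (selected rho) false)
                     (sample_law R L h e (selected rho) true)].
  by split; [apply: distr|apply: distr|apply: le_trans eps_le _; apply: sample_law_far].
have := gap _ _ _ _ Z0 (distr (fun=> false) true) far.
move: close; rewrite same => close /le_trans/(_ close); clear; lra.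
Qed.

Lemma powR_ratioX (R : realType) (a : R) (p q : nat) : 0 <= a -> (0 < q)%N ->
  (a `^ (p%:R / q%:R)) ^+ q = a ^+ p.
Proof.
move=> a0 q0; rewrite -powR_mulrn ?powR_ge0 // -powRrM divfK ?powR_mulrn //.
by rewrite pnatr_eq0 -lt0n.
Qed.

Theorem theorem4p6 (R : realType) :
  exists c : R, 0 < c /\
    forall (k : nat) (eps : R), (2 < k)%N -> 0 < eps -> eps <= 2 ->
      exists N : nat, (0 < N)%N /\
        forall A : algorithm R N, Ak_closeness_tester k eps A ->
          c * Num.max (k%:R `^ (4 / 5) / eps `^ (6 / 5))
                      (k%:R `^ (1 / 2) / eps ^+ 2)
          <= (nsamples A)%:R.
Proof.
(* Chosen so that [2^13 * c^5 * (2^14)^4 = 2^-11] is below [1 / 100], where [2^13 = 8192] and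
   [2^14 = 16 * 1024]; the other uses of [c] ask for less. *)
pose c : R := 2 ^- 16; have c0 : 0 < c by rewrite invr_gt0 exprn_gt0.
exists c; split=> // k eps k2 e0 e2.
have k1 : 1 <= k%:R :> R by rewrite ler1n (leq_trans _ k2).
have kR : 0 < k%:R :> R by apply: lt_le_trans k1.
set X := _ / eps `^ _; set Y := _ / eps ^+ 2.
have X0 : 0 < X by rewrite divr_gt0 ?powR_gt0.
have Y0 : 0 < Y by rewrite divr_gt0 ?powR_gt0 ?exprn_gt0.
have [[cge0 ege0] kge0] := (ltW c0, ltW e0, ltW kR).
have [Xge0 Yge0] := (ltW X0, ltW Y0).
have X5 : X ^+ 5 * eps ^+ 6 = k%:R ^+ 4.
  rewrite /X expr_div_n -(@powR_ratioX _ eps 6 5)  // divfK ?powR_ratioX ?ltW //.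
  by rewrite expf_neq0 // gt_eqF // powR_gt0.
have Y2 : Y ^+ 2 * eps ^+ 4 = k%:R.
  rewrite /Y expr_div_n -exprM divfK ?gt_eqF ?exprn_gt0 //.
  exact: (powR_ratioX 1 (ltW kR)).
have XY : X ^+ 10 * eps ^+ 12 * k%:R ^+ 5 = Y ^+ 10 * eps ^+ 20 * k%:R ^+ 8.
  have -> : X ^+ 10 * eps ^+ 12 = (X ^+ 5 * eps ^+ 6) ^+ 2 by ring.
  have -> : Y ^+ 10 * eps ^+ 20 = (Y ^+ 2 * eps ^+ 4) ^+ 5 by ring.
  by rewrite X5 Y2; ring.
(* The comparison of [X] and [Y] is that of [eps^8 * k^3] with 1. It provides each construction with
   its hypothesis: [k * eps >= 1] if [Y <= X], and [eps <= 1] if [X < Y]. *)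
have XY' : X ^+ 10 = Y ^+ 10 * (eps ^+ 8 * k%:R ^+ 3).
  apply: (mulIf (x := eps ^+ 12 * k%:R ^+ 5)).
    by rewrite mulf_neq0 ?expf_neq0 ?gt_eqF.
  by rewrite mulrA XY; ring.
have [YX|XltY] := leP Y X.
  have ke : 1 <= k%:R * eps.
    rewrite leNgt; apply/negP => ke.
    have e1 : eps < 1 by apply: le_lt_trans ke; rewrite ler_peMl.
    have : Y ^+ 10 <= X ^+ 10 by apply: lerXn2r; rewrite ?nnegrE.
    rewrite XY' leNgt gtr_pMr ?exprn_gt0 // -leNgt.
    have -> : eps ^+ 8 * k%:R ^+ 3 = (k%:R * eps) ^+ 3 * eps ^+ 5 by ring.
    rewrite leNgt => /negP; apply.
    by apply: mulr_ilt1; rewrite ?exprn_ge0 ?exprn_ilt1 ?mulr_ge0.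
  (* The domain given by Ramsey's theorem depends on the number of samples, so [n] is fixed before
     any algorithm, as the largest number to be excluded. *)
  pose n := Num.truncn (c * X).
  have cX0 : 0 <= c * X by rewrite mulr_ge0.
  have nX : n%:R <= c * X by rewrite truncn_le.
  have nk : n%:R ^+ 5 * eps ^+ 6 <= c ^+ 5 * k%:R ^+ 4.
    have -> : c ^+ 5 * k%:R ^+ 4 = (c * X) ^+ 5 * eps ^+ 6 by rewrite -X5; ring.
    rewrite ler_wpM2r ?exprn_ge0 //.
    by apply: lerXn2r; rewrite ?nnegrE.
  have C1 : (0 < 1024)%N by [].
  have Ec : (16 * 1024)%:R * c <= 2.
    by rewrite natrM /c; lra.
  have [K [r [L [D [[K0 r0 L0 LD] KL Kr small eps_le]]]]] :=
    many_samples_params C1 c0 Ec k2 e0 e2 ke nk.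
  have small' : 8192 * n%:R * (L%:R / (D%:R ^+ 3 * r%:R)) ^+ 2 <= 1 / 100 :> R.
    move: small; rewrite -mulrA natrM /c; lra.
  have [N [N0 hN]] := order_lower_bound K0 r0 L0 LD KL Kr small' eps_le.
  exists N; split=> // A tA; rewrite leNgt; apply/negP => nA.
  by apply: (hN A) => //; rewrite truncn_ge_nat // ltW.
have e1 : eps <= 1.
  rewrite leNgt; apply/negP => e1.
  have : X ^+ 10 < Y ^+ 10 by rewrite ltr_pXn2r ?nnegrE.
  rewrite XY' gtr_pMr ?exprn_gt0 // ltNge => /negP; apply.
  by rewrite mulr_ege1 // exprn_ege1 // ltW.
pose h := k./2.
have h0 : (0 < h)%N by rewrite /h; clear -k2; lia.
have hk : (h + h <= k)%N by rewrite /h; clear; lia.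
have kh : (k <= 3 * h)%N by rewrite /h; clear -k2; lia.
exists (h + h)%N; split=> [|A tA]; first by rewrite addn_gt0 h0.
rewrite leNgt; apply/negP => nA.
(* The domain [h + h] does not depend on the number of samples, so the algorithm's own count can be
   used. *)
apply: (@uniformity_lower_bound R h k (nsamples A) eps A) => //.
have hR : 0 < h%:R :> R by rewrite ltr0n.
rewrite ler_pdivrMr //.
apply: (@le_trans _ _ ((c * Y) ^+ 2 * eps ^+ 4)).
  rewrite ler_wpM2r ?exprn_ge0 //.
  by apply: lerXn2r; [rewrite nnegrE ler0n|rewrite nnegrE mulr_ge0|exact: ltW].
rewrite exprMn -mulrA Y2.
have : k%:R <= 3 * h%:R :> R by rewrite -natrM ler_nat.
by rewrite /c; move: hR; clear; lra.
Qed.
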